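(* Let $k$ be an algebraically closed field of characteristic not equal to $2$, let $m,n\ge 0$ be integers, and let $V$ be a finite-dimensional $GL(m|n)$-supermodule. Then the following hold. 1. $V=\bigoplus_{z\in\mathbb{Z}}V_z$, where $V_z$ is a supermodule of rational degree $z$. 2. Each $V_z$ is the union of an ascending chain of $GL(m|n)$-supermodules as follows: (a) If $z\ge 0$, then $V_{z,0}\subseteq V_{z+1,1}\subseteq\dots\subseteq V_{z+t,t}\subseteq\dots$, where $V_{z+t,t}$ is a supermodule of bidegree $(z+t,t)$ and $V_z=\bigcup_{t=0}^{\infty}V_{z+t,t}$. (b) If $z<0$, then $V_{0,-z}\subseteq V_{1,-z+1}\subseteq\dots\subseteq V_{t,-z+t}\subseteq\dots$, where $V_{t,-z+t}$ is a supermodule of bidegree $(t,-z+t)$ and $V_z=\bigcup_{t=0}^{\infty}V_{t,-z+t}$.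
   Context: Superspaces are $\mathbb{Z}/2$-graded $k$-vector spaces; morphisms and structure maps of superalgebras, supercoalgebras, supercomodules are even linear maps; the tensor product of superalgebras has multiplication $(x\otimes y)(w\otimes z)=(-1)^{|y||w|}xw\otimes yz$ on homogeneous elements. For $1\le i\le m+n$ put $|i|=0$ if $i\le m$ and $|i|=1$ if $i>m$. $\mathcal{A}(m|n)=k[x_{ij}:1\le i,j\le m+n]$ is the free supercommutative superalgebra on variables $x_{ij}$ of parity $|i|+|j| \bmod 2$. The coordinate superalgebra $k[GL(m|n)]$ is the localization of $\mathcal{A}(m|n)$ at $d_1d_2$, where $d_1=\det(x_{ij})_{1\le i,j\le m}$ and $d_2=\det(x_{ij})_{m+1\le i,j\le m+n}$. It is a Hopf superalgebra with $\Delta(x_{ij})=\sum_{l}x_{il}\otimes x_{lj}$ and $\epsilon(x_{ij})=\delta_{ij}$. The matrix $(x_{ij})_{1\le i,j\le m+n}$ is invertible over $k[GL(m|n)]$; $\tilde{x}_{ij}$ denotes the $(i,j)$ entry of its inverse. A (left) $GL(m|n)$-supermodule means, equivalently, a right $k[GL(m|n)]$-supercomodule $M$ with structure map $\tau:M\to M\otimes_k k[GL(m|n)]$. If $\{v_1,\dots,v_r\}$ is a homogeneous basis of a finite-dimensional $M$ and $\tau(v_j)=\sum_i v_i\otimes a_{ij}$, the coefficient space is $cf(M)=\operatorname{span}_k\{a_{ij}\}$ (independent of the basis). For integers $r,s\ge0$, $\tilde{\mathcal{A}}(m|n;r,s)=cf\big((k^{m|n})^{\otimes r}\otimes((k^{m|n})^*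 )^{\otimes s}\big)$, where $k^{m|n}$ has structure map $\tau(e_i)=\sum_l e_l\otimes x_{li}$; explicitly it is the span of all products of $r$ elements $x_{ij}$ followed by $s$ elements $\tilde{x}_{ij}$. One has $\tilde{\mathcal{A}}(m|n;r,s)\subseteq\tilde{\mathcal{A}}(m|n;r+1,s+1)$. For $z\ge0$ set $\tilde{\mathcal{A}}(m|n)_z=\bigcup_{t\ge0}\tilde{\mathcal{A}}(m|n;z+t,t)$ and $\tilde{\mathcal{A}}(m|n)_{-z}=\bigcup_{t\ge0}\tilde{\mathcal{A}}(m|n;t,z+t)$. A $GL(m|n)$-supermodule $M$ is of rational degree $z$ if $cf(M)\subseteq\tilde{\mathcal{A}}(m|n)_z$. It is of bidegree $(r,s)$ if $cf(M)\subseteq\tilde{\mathcal{A}}(m|n;r,s)$ and $cf(M)\not\subset\tilde{\mathcal{A}}(m|n;r-1,s-1)$ (the second condition being read as vacuous when $r=0$ or $s=0$, where $\tilde{\mathcal{A}}(m|n;r-1,s-1)$ is not defined).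
   Formalization: The exact bidegree (z+t,t), resp. (t,-z+t), is required only of the first chain member and of each member strictly larger than its predecessor; for every t it is false, since the chain in a finite-dimensional V stabilizes (e.g. V=k trivial). *)

(* Defs.v *)
From HB Require Import structures.
From mathcomp Require Import all_boot all_order all_fingroup all_algebra.
From mathcomp Require Import generic_quotient.
From mathcomp Require Import boolp.

Set Implicit Arguments.
Unset Strict Implicit.
Unset Printing Implicit Defensive.

Import GRing.Theory.
Local Open Scope ring_scope.
Local Open Scope quotient_scope.


(* [spart false] and [spart true] are the projections onto the even and the
   odd part. *)
HB.mixin Record isSuper (R : pzRingType) V of GRing.Lmodule R V := {
  spart : bool -> V -> V;
  spart_linear : forall b, linear (spart b);
  spart_idem : forall b c v,
    spart b (spart c v) = if b == c then spart c v else 0;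
  spart_sum : forall v, spart false v + spart true v = v
}.

#[short(type="superType")]
HB.structure Definition Super (R : pzRingType) :=
  {V of isSuper R V & GRing.Lmodule R V}.

#[short(type="superVectType")]
HB.structure Definition SuperVector (R : nzRingType) :=
  {V of isSuper R V & Vector R V}.

HB.instance Definition _ (R : pzRingType) (V : superType R) b :=
  GRing.isLinear.Build R V V *:%R (@spart R V b) (spart_linear b).

Definition homogeneous (R : pzRingType) (V : superType R) (b : bool) (v : V) :=
  spart b v = v.


Inductive tensor_term (U W : Type) :=
  | TensZero
  | TensPure of U & W
  | TensAdd of tensor_term U W & tensor_term U W.
Arguments TensZero {U W}.

Section Tensor.
Variables (k : fieldType) (U W : lmodType k).
Local Notation tt := (tensor_term U W).

Inductive tensor_eqv : tt -> tt -> Prop :=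
  | tens_refl s : tensor_eqv s s
  | tens_sym s t : tensor_eqv s t -> tensor_eqv t s
  | tens_trans s t u : tensor_eqv s t -> tensor_eqv t u -> tensor_eqv s u
  | tens_add s s' t t' : tensor_eqv s s' -> tensor_eqv t t' ->
      tensor_eqv (TensAdd s t) (TensAdd s' t')
  | tens_addA s t u :
      tensor_eqv (TensAdd s (TensAdd t u)) (TensAdd (TensAdd s t) u)
  | tens_addC s t : tensor_eqv (TensAdd s t) (TensAdd t s)
  | tens_add0 s : tensor_eqv (TensAdd TensZero s) s
  | tens_pureDl u u' w :
      tensor_eqv (TensPure (u + u') w) (TensAdd (TensPure u w) (TensPure u' w))
  | tens_pureDr u w w' :
      tensor_eqv (TensPure u (w + w')) (TensAdd (TensPure u w) (TensPure u w'))
  | tens_pureZ c u w : tensor_eqv (TensPure (c *: u) w) (TensPure u (c *: w))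
  | tens_pure0 w : tensor_eqv (TensPure 0 w) TensZero.

HB.instance Definition _ := gen_eqMixin tt.
HB.instance Definition _ := gen_choiceMixin tt.

Definition tensor_eqvb : rel tt := fun s t => `[< tensor_eqv s t >].

Fact tensor_eqvb_refl : reflexive tensor_eqvb.
Proof. by move=> s; apply/asboolP; apply: tens_refl. Qed.
Fact tensor_eqvb_sym : symmetric tensor_eqvb.
Proof.
by move=> s t; apply/asboolP/asboolP; apply: tens_sym.
Qed.
Fact tensor_eqvb_trans : transitive tensor_eqvb.
Proof.
by move=> t s u /asboolP st /asboolP tu; apply/asboolP; apply: tens_trans tu.
Qed.

Canonical tensor_equiv :=
  EquivRel tensor_eqvb tensor_eqvb_refl tensor_eqvb_sym tensor_eqvb_trans.

Definition tensor := {eq_quot tensor_equiv}.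
HB.instance Definition _ := Choice.on tensor.
HB.instance Definition _ := EqQuotient.on tensor.

Definition tclass (s : tt) : tensor := \pi_tensor s.

Lemma tclassP s t : tclass s = tclass t <-> tensor_eqv s t.
Proof.
split; first by move/eqmodP/asboolP.
by move=> st; apply/eqmodP/asboolP.
Qed.

Lemma tclass_repr (x : tensor) : tclass (repr x) = x.
Proof. exact: reprK. Qed.

Lemma tensor_repr_class s : tensor_eqv (repr (tclass s)) s.
Proof. by apply/tclassP; rewrite tclass_repr. Qed.

Lemma tclassW (P : tensor -> Prop) : (forall s, P (tclass s)) -> forall x, P x.
Proof. by move=> h x; rewrite -(tclass_repr x). Qed.

Definition pure (u : U) (w : W) : tensor := tclass (TensPure u w).

Fixpoint tensor_term_scale (c : k) (s : tt) : tt :=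
  match s with
  | TensZero => TensZero
  | TensPure u w => TensPure (c *: u) w
  | TensAdd s t => TensAdd (tensor_term_scale c s) (tensor_term_scale c t)
  end.

Lemma tensor_term_scale_eqv c s t :
  tensor_eqv s t -> tensor_eqv (tensor_term_scale c s) (tensor_term_scale c t).
Proof.
elim=> //=; do ?by move=> *; constructor.
- by move=> *; apply: tens_trans; eauto.
- by move=> u u' w; rewrite scalerDr; constructor.
- by move=> d u w; rewrite scalerA mulrC -scalerA; constructor.
- by move=> w; rewrite scaler0; constructor.
Qed.

Definition tensor_zero : tensor := tclass TensZero.
Definition tensor_add (x y : tensor) : tensor :=
  tclass (TensAdd (repr x) (repr y)).
Definition tensor_scale (c : k) (x : tensor) : tensor :=
  tclass (tensor_term_scale c (repr x)).
Definition tensor_opp (x : tensor) : tensor := tensor_scale (-1) x.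

Lemma tclassD s t : tensor_add (tclass s) (tclass t) = tclass (TensAdd s t).
Proof. by apply/tclassP/tens_add; apply: tensor_repr_class. Qed.
Lemma tclassZ c s :
  tensor_scale c (tclass s) = tclass (tensor_term_scale c s).
Proof. by apply/tclassP/tensor_term_scale_eqv/tensor_repr_class. Qed.

Fact tensor_addA : associative tensor_add.
Proof.
elim/tclassW=> s; elim/tclassW=> t; elim/tclassW=> u; rewrite !tclassD.
exact/tclassP/tens_addA.
Qed.
Fact tensor_addC : commutative tensor_add.
Proof.
elim/tclassW=> s; elim/tclassW=> t; rewrite !tclassD; exact/tclassP/tens_addC.
Qed.
Fact tensor_add0 : left_id tensor_zero tensor_add.
Proof. elim/tclassW=> s; rewrite tclassD; exact/tclassP/tens_add0. Qed.

Lemma tensor_term_scale_eqv0 s :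
  tensor_eqv (tensor_term_scale 0 s) TensZero.
Proof.
elim: s => //=; first exact: tens_refl.
  by move=> u w; rewrite scale0r; constructor.
move=> s IHs t IHt; apply: tens_trans (tens_add0 _); exact: tens_add.
Qed.

Lemma tensor_term_scaleDl c d s :
  tensor_eqv (tensor_term_scale (c + d) s)
    (TensAdd (tensor_term_scale c s) (tensor_term_scale d s)).
Proof.
elim: s => /=.
- exact/tens_sym/tens_add0.
- by move=> u w; rewrite scalerDl; constructor.
- move=> s IHs t IHt.
  apply: tens_trans (tens_add IHs IHt) _.
  set a := tensor_term_scale c s; set b := tensor_term_scale d s.
  set a' := tensor_term_scale c t; set b' := tensor_term_scale d t.
  by apply/tclassP; rewrite -!tclassD -!tensor_addA; congr tensor_add;
     rewrite !tensor_addA; congr tensor_add; rewrite tensor_addC.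
Qed.

Lemma tensor_term_scale1 s : tensor_term_scale 1 s = s.
Proof. by elim: s => //= [u w|s -> t ->//]; rewrite scale1r. Qed.

Lemma tensor_term_scaleA c d s :
  tensor_term_scale c (tensor_term_scale d s) = tensor_term_scale (c * d) s.
Proof. by elim: s => //= [u w|s -> t ->//]; rewrite scalerA. Qed.

Fact tensor_addN : left_inverse tensor_zero tensor_opp tensor_add.
Proof.
elim/tclassW=> s; rewrite /tensor_opp tclassZ tclassD; apply/tclassP.
rewrite -{2}[s]tensor_term_scale1.
apply: tens_trans (tens_sym (tensor_term_scaleDl _ _ _)) _.
rewrite addNr; exact: tensor_term_scale_eqv0.
Qed.

HB.instance Definition _ :=
  GRing.isZmodule.Build tensor tensor_addA tensor_addC tensor_add0 tensor_addN.

Fact tensor_scaleA c d x :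
  tensor_scale c (tensor_scale d x) = tensor_scale (c * d) x.
Proof. by elim/tclassW: x => s; rewrite !tclassZ tensor_term_scaleA. Qed.
Fact tensor_scale1 : left_id 1 tensor_scale.
Proof. by elim/tclassW=> s; rewrite tclassZ tensor_term_scale1. Qed.
Fact tensor_scaleDr : right_distributive tensor_scale +%R.
Proof.
by move=> c; elim/tclassW=> s; elim/tclassW=> t;
   rewrite /GRing.add /= !(tclassD, tclassZ).
Qed.
Fact tensor_scaleDl x : {morph tensor_scale^~ x : c d / c + d}.
Proof.
move=> c d; elim/tclassW: x => s; rewrite {2}/GRing.add /= !(tclassD, tclassZ).
exact/tclassP/tensor_term_scaleDl.
Qed.

HB.instance Definition _ := GRing.Zmodule_isLmodule.Build k tensor
  tensor_scaleA tensor_scale1 tensor_scaleDr tensor_scaleDl.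

Lemma tclass_add s t : tclass s + tclass t = tclass (TensAdd s t).
Proof. exact: tclassD. Qed.
Lemma tclass_scale c s : c *: tclass s = tclass (tensor_term_scale c s).
Proof. exact: tclassZ. Qed.

Lemma pureDl u u' w : pure (u + u') w = pure u w + pure u' w.
Proof. by rewrite /pure tclass_add; apply/tclassP; constructor. Qed.
Lemma pureDr u w w' : pure u (w + w') = pure u w + pure u w'.
Proof. by rewrite /pure tclass_add; apply/tclassP; constructor. Qed.
Lemma pureZl c u w : pure (c *: u) w = c *: pure u w.
Proof. by rewrite /pure tclass_scale. Qed.
Lemma pureZr c u w : pure u (c *: w) = c *: pure u w.
Proof. by rewrite -pureZl; apply/tclassP/tens_sym; constructor. Qed.

Lemma tensor_ind (P : tensor -> Prop) :
    (forall u w, P (pure u w)) -> P 0 ->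
    (forall x y, P x -> P y -> P (x + y)) -> forall x, P x.
Proof.
move=> Pp P0 PD; elim/tclassW; elim=> [|u w|s Ps t Pt]; [exact: P0|exact: Pp|].
by rewrite -tclass_add; apply: PD.
Qed.

Definition bilinear_map (Z : lmodType k) (f : U -> W -> Z) :=
  (forall w, linear (f^~ w)) /\ (forall u, linear (f u)).

Fixpoint tensor_term_eval (Z : zmodType) (f : U -> W -> Z) (s : tt) : Z :=
  match s with
  | TensZero => 0
  | TensPure u w => f u w
  | TensAdd s t => tensor_term_eval f s + tensor_term_eval f t
  end.

(* The linear map induced by a bilinear map [f]; it is computed on a
   representative, so it is meaningful for bilinear [f] only. *)
Definition tlift (Z : zmodType) (f : U -> W -> Z) (x : tensor) : Z :=
  tensor_term_eval f (repr x).

Section TliftTheory.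
Variables (Z : lmodType k) (f : U -> W -> Z).
Hypothesis f_bilin : bilinear_map f.

Lemma tensor_term_eval_eqv s t :
  tensor_eqv s t -> tensor_term_eval f s = tensor_term_eval f t.
Proof.
have [fl fr] := f_bilin.
have fDl w u u' : f (u + u') w = f u w + f u' w.
  by have := fl w 1 u u'; rewrite !scale1r.
have fDr u w w' : f u (w + w') = f u w + f u w'.
  by have := fr u 1 w w'; rewrite !scale1r.
have f0l w : f 0 w = 0.
  by have /eqP := fDl w 0 0; rewrite addr0 -subr_eq subrr eq_sym => /eqP.
have f0r u : f u 0 = 0.
  by have /eqP := fDr u 0 0; rewrite addr0 -subr_eq subrr eq_sym => /eqP.
elim=> {s t} //=.
- by move=> s t u _ -> _ ->.
- by move=> s s' t t' _ -> _ ->.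
- by move=> *; rewrite addrA.
- by move=> *; rewrite addrC.
- by move=> *; rewrite add0r.
- move=> c u w; have := fl w c u 0; have := fr u c w 0.
  by rewrite !addr0 !f0l !f0r !addr0 => -> ->.
Qed.

Lemma tlift_class s : tlift f (tclass s) = tensor_term_eval f s.
Proof. exact/tensor_term_eval_eqv/tensor_repr_class. Qed.

Lemma tlift_pure u w : tlift f (pure u w) = f u w.
Proof. exact: tlift_class. Qed.

Lemma tlift_is_linear : linear (tlift f).
Proof.
have [fl _] := f_bilin.
have fDl w u u' : f (u + u') w = f u w + f u' w.
  by have := fl w 1 u u'; rewrite !scale1r.
have f0l w : f 0 w = 0.
  by have /eqP := fDl w 0 0; rewrite addr0 -subr_eq subrr eq_sym => /eqP.
move=> c; elim/tclassW=> s; elim/tclassW=> t.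
rewrite [_ *: _ + _](_ : _ = tclass (TensAdd (tensor_term_scale c s) t)).
  rewrite !tlift_class /=; congr (_ + _).
  elim: s => /= [|u w|s -> s' ->]; rewrite ?scaler0 ?scalerDr //.
  by have := fl w c u 0; rewrite !addr0 f0l addr0.
by rewrite tclass_scale tclass_add.
Qed.
End TliftTheory.

End Tensor.

Notation "U ⊗ W" := (tensor U%type W%type) (at level 40, left associativity) : type_scope.
Notation "u ⊗ w" := (pure u w) (at level 40, left associativity) : ring_scope.

Section TensorMaps.
Variable k : fieldType.

Definition tmap (U W U' W' : lmodType k) (f : U -> U') (g : W -> W') :
    U ⊗ W -> U' ⊗ W' :=
  tlift (fun u w => f u ⊗ g w).

Definition tassoc (U W Z : lmodType k) : (U ⊗ W) ⊗ Z -> U ⊗ (W ⊗ Z) :=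
  tlift (fun x z => tlift (fun u w => u ⊗ (w ⊗ z)) x).

Lemma tmap_bilinear (U W U' W' : lmodType k)
    (f : {linear U -> U'}) (g : {linear W -> W'}) :
  bilinear_map (fun u w => f u ⊗ g w).
Proof.
split=> [w c u u'|u c w w'].
  by rewrite linearP pureDl pureZl.
by rewrite linearP pureDr pureZr.
Qed.

Lemma tmap_pure (U W U' W' : lmodType k)
    (f : {linear U -> U'}) (g : {linear W -> W'}) u w :
  tmap f g (u ⊗ w) = f u ⊗ g w.
Proof. exact: (tlift_pure (tmap_bilinear f g)). Qed.

Lemma tmap_linear (U W U' W' : lmodType k)
    (f : {linear U -> U'}) (g : {linear W -> W'}) : linear (tmap f g).
Proof. exact: (tlift_is_linear (tmap_bilinear f g)). Qed.

Section TensorSuper.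
Variables U W : superType k.

Definition tensor_spart (b : bool) (x : U ⊗ W) : U ⊗ W :=
  tmap (spart false) (spart b) x + tmap (spart true) (spart (~~ b)) x.

Fact tensor_spart_linear b : linear (tensor_spart b).
Proof.
move=> c x y; rewrite /tensor_spart !tmap_linear scalerDr.
by rewrite addrACA.
Qed.

Lemma tensor_spart_pure b u w :
  tensor_spart b (u ⊗ w) =
  spart false u ⊗ spart b w + spart true u ⊗ spart (~~ b) w.
Proof. by rewrite /tensor_spart !tmap_pure. Qed.

Lemma pure0l w : (0 : U) ⊗ w = 0 :> U ⊗ W.
Proof. by rewrite -(scale0r (0 : U)) pureZl scale0r. Qed.
Lemma pure0r u : u ⊗ (0 : W) = 0 :> U ⊗ W.
Proof. by rewrite -(scale0r (0 : W)) pureZr scale0r. Qed.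

Let tsD b x y : tensor_spart b (x + y) = tensor_spart b x + tensor_spart b y.
Proof. by have := tensor_spart_linear b 1 x y; rewrite !scale1r. Qed.
Let ts0 b : tensor_spart b 0 = 0.
Proof.
by have /eqP := tsD b 0 0; rewrite addr0 -subr_eq subrr eq_sym => /eqP.
Qed.

Fact tensor_spart_idem b c x :
  tensor_spart b (tensor_spart c x) = if b == c then tensor_spart c x else 0.
Proof.
elim/tensor_ind: x => [u w||x y IHx IHy].
- rewrite (tensor_spart_pure c) tsD !tensor_spart_pure !spart_idem /=.
  by case: b; case: c => /=; rewrite ?pure0l ?pure0r ?addr0 ?add0r.
- by rewrite !ts0; case: ifP.
- by rewrite (tsD c) (tsD b) IHx IHy; case: ifP; rewrite ?addr0.
Qed.

Fact tensor_spart_sum x : tensor_spart false x + tensor_spart true x = x.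
Proof.
elim/tensor_ind: x => [u w||x y IHx IHy].
- rewrite !tensor_spart_pure /= addrACA [X in _ + X]addrC -!pureDr !spart_sum.
  by rewrite -pureDl spart_sum.
- by rewrite !ts0 addr0.
- by rewrite (tsD false) (tsD true) addrACA IHx IHy.
Qed.

HB.instance Definition _ := isSuper.Build k (tensor U W)
  tensor_spart_linear tensor_spart_idem tensor_spart_sum.

End TensorSuper.
End TensorMaps.


Section CoordinateSuperalgebra.
Variables (k : fieldType) (m n : nat).

(* Indices are numbered from 0. *)
Definition ipar (i : 'I_(m + n)) : bool := (m <= i)%N.

Lemma ipar_lshift (i : 'I_m) : ipar (lshift n i) = false.
Proof. by apply/negbTE; rewrite -ltnNge; apply: (ltn_ord i). Qed.
Lemma ipar_rshift (i : 'I_n) : ipar (rshift m i) = true.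
Proof. exact: leq_addr. Qed.

Inductive gl_term :=
  | GlCst of k
  | GlVar of 'I_(m + n) & 'I_(m + n)
  | GlInv
  | GlAdd of gl_term & gl_term
  | GlMul of gl_term & gl_term.

Definition gl_term_det p (e : 'I_p -> 'I_p -> gl_term) : gl_term :=
  \big[GlAdd/GlCst 0]_(s : 'S_p)
    GlMul (GlCst ((-1) ^+ s)) (\big[GlMul/GlCst 1]_(i < p) e i (s i)).

Definition gl_term_d1 := gl_term_det (fun i j : 'I_m =>
  GlVar (lshift n i) (lshift n j)).
Definition gl_term_d2 := gl_term_det (fun i j : 'I_n =>
  GlVar (rshift m i) (rshift m j)).
Definition gl_term_d := GlMul gl_term_d1 gl_term_d2.

(* k[GL(m|n)] is presented by the supercommuting generators [GlVar i j] and a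
   two-sided inverse [GlInv] of d1 d2.  When 2 is invertible, the relation
   [gl_supercomm] for an odd variable and itself says that its square is 0, so
   that without [GlInv] this is the free supercommutative superalgebra; d1 d2
   is even, hence central there, and adjoining an inverse of it is the
   localization. *)
Inductive gl_eqv : gl_term -> gl_term -> Prop :=
  | gl_refl s : gl_eqv s s
  | gl_sym s t : gl_eqv s t -> gl_eqv t s
  | gl_trans s t u : gl_eqv s t -> gl_eqv t u -> gl_eqv s u
  | gl_add s s' t t' : gl_eqv s s' -> gl_eqv t t' ->
      gl_eqv (GlAdd s t) (GlAdd s' t')
  | gl_mul s s' t t' : gl_eqv s s' -> gl_eqv t t' ->
      gl_eqv (GlMul s t) (GlMul s' t')
  | gl_addA s t u : gl_eqv (GlAdd s (GlAdd t u)) (GlAdd (GlAdd s t) u)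
  | gl_addC s t : gl_eqv (GlAdd s t) (GlAdd t s)
  | gl_add0 s : gl_eqv (GlAdd (GlCst 0) s) s
  | gl_mulA s t u : gl_eqv (GlMul s (GlMul t u)) (GlMul (GlMul s t) u)
  | gl_mul1l s : gl_eqv (GlMul (GlCst 1) s) s
  | gl_mul0l s : gl_eqv (GlMul (GlCst 0) s) (GlCst 0)
  | gl_mulDl s t u :
      gl_eqv (GlMul (GlAdd s t) u) (GlAdd (GlMul s u) (GlMul t u))
  | gl_mulDr s t u :
      gl_eqv (GlMul s (GlAdd t u)) (GlAdd (GlMul s t) (GlMul s u))
  | gl_cstD a b : gl_eqv (GlCst (a + b)) (GlAdd (GlCst a) (GlCst b))
  | gl_cstM a b : gl_eqv (GlCst (a * b)) (GlMul (GlCst a) (GlCst b))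
  | gl_cst_comm a s : gl_eqv (GlMul (GlCst a) s) (GlMul s (GlCst a))
  | gl_supercomm i j l p :
      gl_eqv (GlMul (GlVar i j) (GlVar l p))
        (GlMul (GlCst ((-1) ^+ ((ipar i (+) ipar j) && (ipar l (+) ipar p))))
           (GlMul (GlVar l p) (GlVar i j)))
  | gl_invl : gl_eqv (GlMul GlInv gl_term_d) (GlCst 1)
  | gl_invr : gl_eqv (GlMul gl_term_d GlInv) (GlCst 1).

HB.instance Definition _ := gen_eqMixin gl_term.
HB.instance Definition _ := gen_choiceMixin gl_term.

Definition gl_eqvb : rel gl_term := fun s t => `[< gl_eqv s t >].

Fact gl_eqvb_refl : reflexive gl_eqvb.
Proof. by move=> s; apply/asboolP; apply: gl_refl. Qed.
Fact gl_eqvb_sym : symmetric gl_eqvb.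
Proof. by move=> s t; apply/asboolP/asboolP; apply: gl_sym. Qed.
Fact gl_eqvb_trans : transitive gl_eqvb.
Proof.
by move=> t s u /asboolP st /asboolP tu; apply/asboolP; apply: gl_trans tu.
Qed.

Canonical gl_equiv :=
  EquivRel gl_eqvb gl_eqvb_refl gl_eqvb_sym gl_eqvb_trans.

Definition coordGL := {eq_quot gl_equiv}.
HB.instance Definition _ := Choice.on coordGL.
HB.instance Definition _ := EqQuotient.on coordGL.

Definition glclass (s : gl_term) : coordGL := \pi_coordGL s.

Lemma glclassP s t : glclass s = glclass t <-> gl_eqv s t.
Proof.
split; first by move/eqmodP/asboolP.
by move=> st; apply/eqmodP/asboolP.
Qed.

Lemma glclass_repr (x : coordGL) : glclass (repr x) = x.
Proof. exact: reprK. Qed.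

Lemma gl_repr_class s : gl_eqv (repr (glclass s)) s.
Proof. by apply/glclassP; rewrite glclass_repr. Qed.

Lemma glclassW (P : coordGL -> Prop) :
  (forall s, P (glclass s)) -> forall x, P x.
Proof. by move=> h x; rewrite -(glclass_repr x). Qed.

Definition coordGL_add (x y : coordGL) : coordGL :=
  glclass (GlAdd (repr x) (repr y)).
Definition coordGL_mul (x y : coordGL) : coordGL :=
  glclass (GlMul (repr x) (repr y)).
Definition coordGL_cst (c : k) : coordGL := glclass (GlCst c).
Definition coordGL_opp (x : coordGL) := coordGL_mul (coordGL_cst (-1)) x.
Definition coordGL_scale c (x : coordGL) := coordGL_mul (coordGL_cst c) x.

Lemma glclassD s t : coordGL_add (glclass s) (glclass t) = glclass (GlAdd s t).
Proof. by apply/glclassP/gl_add; apply: gl_repr_class. Qed.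
Lemma glclassM s t : coordGL_mul (glclass s) (glclass t) = glclass (GlMul s t).
Proof. by apply/glclassP/gl_mul; apply: gl_repr_class. Qed.

Fact coordGL_addA : associative coordGL_add.
Proof.
elim/glclassW=> s; elim/glclassW=> t; elim/glclassW=> u; rewrite !glclassD.
exact/glclassP/gl_addA.
Qed.
Fact coordGL_addC : commutative coordGL_add.
Proof.
elim/glclassW=> s; elim/glclassW=> t; rewrite !glclassD; exact/glclassP/gl_addC.
Qed.
Fact coordGL_add0 : left_id (coordGL_cst 0) coordGL_add.
Proof. elim/glclassW=> s; rewrite glclassD; exact/glclassP/gl_add0. Qed.
Fact coordGL_mulA : associative coordGL_mul.
Proof.
elim/glclassW=> s; elim/glclassW=> t; elim/glclassW=> u; rewrite !glclassM.
exact/glclassP/gl_mulA.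
Qed.
Fact coordGL_mul1l : left_id (coordGL_cst 1) coordGL_mul.
Proof. elim/glclassW=> s; rewrite glclassM; exact/glclassP/gl_mul1l. Qed.
Lemma coordGL_cst_comm c x :
  coordGL_mul (coordGL_cst c) x = coordGL_mul x (coordGL_cst c).
Proof.
elim/glclassW: x => s; rewrite !glclassM; exact/glclassP/gl_cst_comm.
Qed.
Fact coordGL_mul1r : right_id (coordGL_cst 1) coordGL_mul.
Proof. by move=> x; rewrite -coordGL_cst_comm coordGL_mul1l. Qed.
Fact coordGL_mulDl : left_distributive coordGL_mul coordGL_add.
Proof.
elim/glclassW=> s; elim/glclassW=> t; elim/glclassW=> u.
rewrite !(glclassD, glclassM); exact/glclassP/gl_mulDl.
Qed.
Fact coordGL_mulDr : right_distributive coordGL_mul coordGL_add.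
Proof.
elim/glclassW=> s; elim/glclassW=> t; elim/glclassW=> u.
rewrite !(glclassD, glclassM); exact/glclassP/gl_mulDr.
Qed.
Lemma coordGL_cstD c d :
  coordGL_cst (c + d) = coordGL_add (coordGL_cst c) (coordGL_cst d).
Proof. rewrite glclassD; exact/glclassP/gl_cstD. Qed.
Lemma coordGL_cstM c d :
  coordGL_cst (c * d) = coordGL_mul (coordGL_cst c) (coordGL_cst d).
Proof. rewrite glclassM; exact/glclassP/gl_cstM. Qed.
Fact coordGL_addN : left_inverse (coordGL_cst 0) coordGL_opp coordGL_add.
Proof.
move=> x; rewrite /coordGL_opp -{2}[x]coordGL_mul1l -coordGL_mulDl.
rewrite -coordGL_cstD addNr; elim/glclassW: x => s; rewrite glclassM.
exact/glclassP/gl_mul0l.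
Qed.

HB.instance Definition _ := GRing.isZmodule.Build coordGL
  coordGL_addA coordGL_addC coordGL_add0 coordGL_addN.
HB.instance Definition _ := GRing.Zmodule_isPzRing.Build coordGL
  coordGL_mulA coordGL_mul1l coordGL_mul1r coordGL_mulDl coordGL_mulDr.

Lemma scalar_sign (B : algType k) (b : bool) :
  ((-1) ^+ b)%:A = (-1) ^+ b :> B.
Proof. by case: b; rewrite ?scaleN1r ?scale1r. Qed.

(* Evaluation of terms; by [gl_eval_eqv] it induces the algebra morphisms out
   of k[GL(m|n)]. *)
Fixpoint gl_eval (B : algType k) (f : 'I_(m + n) -> 'I_(m + n) -> B) (v : B)
    (s : gl_term) : B :=
  match s with
  | GlCst c => c%:A
  | GlVar i j => f i j
  | GlInv => v
  | GlAdd s t => gl_eval f v s + gl_eval f v t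
  | GlMul s t => gl_eval f v s * gl_eval f v t
  end.

Section Eval.
Variables (B : algType k) (f : 'I_(m + n) -> 'I_(m + n) -> B) (v : B).

Lemma gl_eval_det p (e : 'I_p -> 'I_p -> gl_term) :
  gl_eval f v (gl_term_det e) = \det (\matrix_(i, j) gl_eval f v (e i j)).
Proof.
rewrite /gl_term_det /determinant.
rewrite (big_morph (gl_eval f v) (id1 := 0) (op1 := +%R)) //=; last first.
  by rewrite scale0r.
apply: eq_bigr => s _; rewrite scalar_sign.
rewrite (big_morph (gl_eval f v) (id1 := 1) (op1 := *%R)) //=; last first.
  by rewrite scale1r.
by congr (_ * _); apply: eq_bigr => i _; rewrite mxE.
Qed.

Hypothesis f_comm : forall i j l p,
  f i j * f l p =
  (-1) ^+ ((ipar i (+) ipar j) && (ipar l (+) ipar p)) * (f l p * f i j).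
Hypothesis vd : v * (\det (\matrix_(i, j) f (lshift n i) (lshift n j)) *
                     \det (\matrix_(i, j) f (rshift m i) (rshift m j))) = 1.
Hypothesis dv : (\det (\matrix_(i, j) f (lshift n i) (lshift n j)) *
                 \det (\matrix_(i, j) f (rshift m i) (rshift m j))) * v = 1.

Lemma gl_eval_eqv s t : gl_eqv s t -> gl_eval f v s = gl_eval f v t.
Proof.
elim=> {s t} //=.
- by move=> s t u _ -> _ ->.
- by move=> s s' t t' _ -> _ ->.
- by move=> s s' t t' _ -> _ ->.
- by move=> *; rewrite addrA.
- by move=> *; rewrite addrC.
- by move=> *; rewrite scale0r add0r.
- by move=> *; rewrite mulrA.
- by move=> *; rewrite scale1r mul1r.
- by move=> *; rewrite scale0r mul0r.
- by move=> *; rewrite mulrDl.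
- by move=> *; rewrite mulrDr.
- by move=> *; rewrite scalerDl.
- by move=> *; rewrite -scalerAl mul1r scalerA.
- by move=> *; rewrite -scalerAl -scalerAr mul1r mulr1.
- by move=> i j l p; rewrite scalar_sign.
- by rewrite !gl_eval_det vd scale1r.
- by rewrite !gl_eval_det dv scale1r.
Qed.

End Eval.

Fact coordGL_1neq0 : (1 : coordGL) != 0.
Proof.
apply/eqP => /glclassP e10.
have detI p (e : 'I_p -> 'I_(m + n)) : injective e ->
    \det (\matrix_(i, j) ((e i == e j)%:R : k^o)) = 1.
  move=> e_inj; rewrite -[RHS](det1 k p); congr (\det _).
  by apply/matrixP => i j; rewrite !mxE (inj_eq e_inj).
have fC (i j l p : 'I_(m + n)) : (i == j)%:R * (l == p)%:R =
    (-1) ^+ ((ipar i (+) ipar j) && (ipar l (+) ipar p)) *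
      ((l == p)%:R * (i == j)%:R) :> k^o.
  have [->|ij] := eqVneq i j; last by rewrite mul0r !mulr0.
  by rewrite addbb /= expr0 !mul1r mulr1.
have := gl_eval_eqv fC (v := 1) _ _ e10.
rewrite !detI; [|exact: rshift_inj|exact: lshift_inj].
rewrite !mulr1 /= scale1r scale0r => /(_ erefl erefl) /eqP.
by rewrite oner_eq0.
Qed.

HB.instance Definition _ := GRing.PzSemiRing_isNonZero.Build coordGL
  coordGL_1neq0.

Lemma glclass_add s t : glclass s + glclass t = glclass (GlAdd s t).
Proof. exact: glclassD. Qed.
Lemma glclass_mul s t : glclass s * glclass t = glclass (GlMul s t).
Proof. exact: glclassM. Qed.
Lemma glclass_cst0 : glclass (GlCst 0) = 0. Proof. by []. Qed.
Lemma glclass_cst1 : glclass (GlCst 1) = 1. Proof. by []. Qed.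

Fact coordGL_scaleA c d x :
  coordGL_scale c (coordGL_scale d x) = coordGL_scale (c * d) x.
Proof. by rewrite /coordGL_scale coordGL_cstM coordGL_mulA. Qed.
Fact coordGL_scale1 : left_id 1 coordGL_scale.
Proof. exact: coordGL_mul1l. Qed.
Fact coordGL_scaleDr : right_distributive coordGL_scale +%R.
Proof. by move=> c; apply: coordGL_mulDr. Qed.
Fact coordGL_scaleDl x : {morph coordGL_scale^~ x : c d / c + d}.
Proof. by move=> c d; rewrite /coordGL_scale coordGL_cstD coordGL_mulDl. Qed.

HB.instance Definition _ := GRing.Zmodule_isLmodule.Build k coordGL
  coordGL_scaleA coordGL_scale1 coordGL_scaleDr coordGL_scaleDl.

Fact coordGL_scaleAl (c : k) (x y : coordGL) : c *: (x * y) = c *: x * y.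
Proof. exact: coordGL_mulA. Qed.
HB.instance Definition _ := GRing.Lmodule_isLalgebra.Build k coordGL
  coordGL_scaleAl.
Fact coordGL_scaleAr (c : k) (x y : coordGL) : c *: (x * y) = x * (c *: y).
Proof.
have cm (z : coordGL) : c *: z = z * coordGL_cst c.
  exact: coordGL_cst_comm.
by rewrite !cm mulrA.
Qed.
HB.instance Definition _ := GRing.Lalgebra_isAlgebra.Build k coordGL
  coordGL_scaleAr.

Lemma glclass_cst c : glclass (GlCst c) = c%:A.
Proof. by rewrite -[LHS]mulr1. Qed.

Definition coordX (i j : 'I_(m + n)) : coordGL := glclass (GlVar i j).
Definition coord_dinv : coordGL := glclass GlInv.

Lemma glclass_eval s : glclass s = gl_eval coordX coord_dinv s.
Proof.
elim: s => //= [c|s <- t <-|s <- t <-].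
- exact: glclass_cst.
- by rewrite glclass_add.
- by rewrite glclass_mul.
Qed.

Definition coord_d1 : coordGL :=
  \det (\matrix_(i < m, j < m) coordX (lshift n i) (lshift n j)).
Definition coord_d2 : coordGL :=
  \det (\matrix_(i < n, j < n) coordX (rshift m i) (rshift m j)).

Lemma glclass_d1 : glclass gl_term_d1 = coord_d1.
Proof. by rewrite glclass_eval gl_eval_det. Qed.
Lemma glclass_d2 : glclass gl_term_d2 = coord_d2.
Proof. by rewrite glclass_eval gl_eval_det. Qed.

Lemma coord_dinvl : coord_dinv * (coord_d1 * coord_d2) = 1.
Proof.
rewrite -glclass_d1 -glclass_d2 !glclass_mul -glclass_cst1.
exact/glclassP/gl_invl.
Qed.
Lemma coord_dinvr : (coord_d1 * coord_d2) * coord_dinv = 1.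
Proof.
rewrite -glclass_d1 -glclass_d2 !glclass_mul -glclass_cst1.
exact/glclassP/gl_invr.
Qed.

Lemma coordX_supercomm i j l p : coordX i j * coordX l p =
  (-1) ^+ ((ipar i (+) ipar j) && (ipar l (+) ipar p)) *
    (coordX l p * coordX i j).
Proof.
rewrite -scalar_sign -glclass_cst /coordX !glclass_mul.
exact/glclassP/gl_supercomm.
Qed.

Fixpoint gl_part (b : bool) (s : gl_term) : coordGL :=
  match s with
  | GlCst c => if b then 0 else c%:A
  | GlVar i j => if ipar i (+) ipar j == b then coordX i j else 0
  | GlInv => if b then 0 else coord_dinv
  | GlAdd s t => gl_part b s + gl_part b t
  | GlMul s t =>
      gl_part false s * gl_part b t + gl_part true s * gl_part (~~ b) t
  end.

Lemma addr4E (V : zmodType) (a b c d : V) : a + d + (b + c) = a + b + (c + d).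
Proof. by rewrite addrACA [d + c]addrC. Qed.

Lemma gl_part_sum s : gl_part false s + gl_part true s = glclass s.
Proof.
elim: s => [c|i j||s IHs t IHt|s IHs t IHt] /=.
- by rewrite addr0 glclass_cst.
- by case: (_ (+) _); rewrite /= ?addr0 ?add0r.
- by rewrite addr0.
- by rewrite addrACA IHs IHt glclass_add.
- rewrite -glclass_mul -IHs -IHt mulrDl !mulrDr; exact: addr4E.
Qed.

Definition gl_even (s : gl_term) := gl_part true s = 0.

Lemma gl_even_add s t : gl_even s -> gl_even t -> gl_even (GlAdd s t).
Proof. by rewrite /gl_even /= => -> ->; rewrite addr0. Qed.
Lemma gl_even_mul s t : gl_even s -> gl_even t -> gl_even (GlMul s t).
Proof. by rewrite /gl_even /= => -> ->; rewrite mulr0 mul0r addr0. Qed.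
Lemma gl_even_det p (e : 'I_p -> 'I_p -> gl_term) :
  (forall i j, gl_even (e i j)) -> gl_even (gl_term_det e).
Proof.
move=> e_even; apply: big_ind => // [|s _]; first exact: gl_even_add.
apply: gl_even_mul => //; apply: big_ind => //; exact: gl_even_mul.
Qed.
Lemma gl_even_d : gl_even gl_term_d.
Proof.
apply: gl_even_mul; apply: gl_even_det => i j; rewrite /gl_even /=.
  by rewrite !ipar_lshift.
by rewrite !ipar_rshift.
Qed.

Lemma gl_part_d b : gl_part b gl_term_d = if b then 0 else glclass gl_term_d.
Proof.
by case: b; rewrite -?gl_part_sum gl_even_d ?addr0.
Qed.

Lemma gl_partM b s t : gl_part b (GlMul s t) =
  gl_part false s * gl_part b t + gl_part true s * gl_part (~~ b) t.
Proof. by []. Qed.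

Lemma gl_part_eqv s t : gl_eqv s t -> forall b, gl_part b s = gl_part b t.
Proof.
elim=> {s t}.
- by [].
- by move=> s t _ IH b.
- by move=> s t u _ IH1 _ IH2 b; rewrite IH1.
- by move=> s s' t t' _ IH1 _ IH2 b /=; rewrite IH1 IH2.
- by move=> s s' t t' _ IH1 _ IH2 b /=; rewrite !IH1 !IH2.
- by move=> s t u b /=; rewrite addrA.
- by move=> s t b /=; rewrite addrC.
- by move=> s b /=; rewrite scale0r if_same add0r.
- move=> s t u b /=; rewrite negbK !mulrDl !mulrDr !mulrA; symmetry; exact: addr4E.
- by move=> s b /=; rewrite scale1r mul1r mul0r addr0.
- by move=> s b /=; rewrite scale0r !mul0r addr0 if_same.
- by move=> s t u b /=; rewrite !mulrDl addrACA.
- by move=> s t u b /=; rewrite !mulrDr addrACA.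
- by move=> c d [] /=; rewrite ?addr0 // scalerDl.
- move=> c d [] /=; rewrite ?(mulr0, mul0r, addr0) //.
  by rewrite -scalerAl mul1r scalerA.
- move=> c s [] /=; rewrite ?(mulr0, mul0r, addr0, add0r);
  by rewrite -scalerAl -scalerAr mul1r mulr1.
- move=> i j l p b /=; have := coordX_supercomm i j l p.
  case: (ipar i (+) ipar j); case: (ipar l (+) ipar p); case: b => /= E;
  by rewrite ?(mulr0, mul0r, addr0, add0r) // E ?expr0 ?expr1 ?scale1r ?scaleN1r.
- move=> b; rewrite gl_partM !gl_part_d /= mul0r addr0 scale1r.
  case: b; first by rewrite mulr0.
  by rewrite /coord_dinv glclass_mul -glclass_cst1; apply/glclassP/gl_invl.
- move=> b; rewrite gl_partM !gl_part_d /= mul0r addr0 scale1r.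
  case: b; first by rewrite mulr0.
  by rewrite /coord_dinv glclass_mul -glclass_cst1; apply/glclassP/gl_invr.
Qed.

Definition coordGL_spart (b : bool) (x : coordGL) : coordGL :=
  gl_part b (repr x).

Lemma coordGL_spart_class b s : coordGL_spart b (glclass s) = gl_part b s.
Proof. exact: (gl_part_eqv (gl_repr_class s)). Qed.

Fact coordGL_spart_linear b : linear (coordGL_spart b).
Proof.
move=> c; elim/glclassW=> s; elim/glclassW=> t.
have -> : c *: glclass s + glclass t = glclass (GlAdd (GlMul (GlCst c) s) t).
  by rewrite -glclass_add -glclass_mul glclass_cst -scalerAl mul1r.
rewrite !coordGL_spart_class /=; congr (_ + _).
by case: b; rewrite mul0r addr0 -scalerAl mul1r.
Qed.

Lemma coordGL_spartM b x y : coordGL_spart b (x * y) =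
  coordGL_spart false x * coordGL_spart b y +
  coordGL_spart true x * coordGL_spart (~~ b) y.
Proof.
elim/glclassW: x => s; elim/glclassW: y => t.
by rewrite glclass_mul !coordGL_spart_class.
Qed.

Fact coordGL_spart_idem b c x :
  coordGL_spart b (coordGL_spart c x) =
  if b == c then coordGL_spart c x else 0.
Proof.
have D b' u v : coordGL_spart b' (u + v) = coordGL_spart b' u + coordGL_spart b' v.
  by have := coordGL_spart_linear b' 1 u v; rewrite !scale1r.
have Z b' : coordGL_spart b' 0 = 0.
  by rewrite -glclass_cst0 coordGL_spart_class /=; case: b'; rewrite ?scale0r.
elim/glclassW: x => s; rewrite coordGL_spart_class.
elim: s b c => [a|i j||s IHs t IHt|s IHs t IHt] b c /=.
- case: c; first by rewrite Z if_same.
  by rewrite -glclass_cst coordGL_spart_class /= glclass_cst; case: b.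
- have [<-|_] := eqVneq; last by rewrite Z if_same.
  by rewrite coordGL_spart_class /= eq_sym.
- by case: c; rewrite ?Z ?if_same // coordGL_spart_class; case: b.
- by rewrite D IHs IHt; case: ifP; rewrite ?addr0.
- rewrite D !coordGL_spartM !IHs !IHt.
  by case: b; case: c; rewrite /= ?(mulr0, mul0r, addr0, add0r).
Qed.

Fact coordGL_spart_sum x : coordGL_spart false x + coordGL_spart true x = x.
Proof. by elim/glclassW: x => s; rewrite !coordGL_spart_class gl_part_sum. Qed.

HB.instance Definition _ := isSuper.Build k coordGL
  coordGL_spart_linear coordGL_spart_idem coordGL_spart_sum.

End CoordinateSuperalgebra.

Arguments coordX k {m n} i j.


Section HopfStructure.
Variables (k : fieldType) (m n : nat).
Local Notation H := (coordGL k m n).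

(* (x ⊗ y)(w ⊗ z) = (-1)^(|y||w|) xw ⊗ yz, summed over the homogeneous
   components of y and w; see [coordGL2_mul_pure]. *)
Definition coordGL2_mul_on (x y w z : H) : H ⊗ H :=
  \sum_(b : bool) \sum_(c : bool)
    (-1) ^+ (b && c) *: ((x * spart c w) ⊗ (spart b y * z)).

Definition coordGL2_mul (s t : H ⊗ H) : H ⊗ H :=
  tlift (fun x y => tlift (coordGL2_mul_on x y) t) s.

Lemma coordGL2_mul_on_bilinear_r x y : bilinear_map (coordGL2_mul_on x y).
Proof.
split=> [z c w w'|w c z z']; rewrite /coordGL2_mul_on scaler_sumr -big_split;
  apply: eq_bigr => b _; rewrite scaler_sumr -big_split /=;
  apply: eq_bigr => d _; rewrite scalerA mulrC -scalerA -scalerDr;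
  congr (_ *: _).
- by rewrite linearP mulrDr -scalerAr pureDl pureZl.
- by rewrite mulrDr -scalerAr pureDr pureZr.
Qed.

Lemma coordGL2_mul_on_bilinear_l w z :
  bilinear_map (fun x y => coordGL2_mul_on x y w z).
Proof.
split=> [y c x x'|x c y y']; rewrite /coordGL2_mul_on scaler_sumr -big_split;
  apply: eq_bigr => b _; rewrite scaler_sumr -big_split /=;
  apply: eq_bigr => d _; rewrite scalerA mulrC -scalerA -scalerDr;
  congr (_ *: _).
- by rewrite mulrDl -scalerAl pureDl pureZl.
- by rewrite linearP mulrDl -scalerAl pureDr pureZr.
Qed.

Lemma coordGL2_mul_bilinear t :
  bilinear_map (fun x y => tlift (coordGL2_mul_on x y) t).
Proof.
have L x y := tlift_is_linear (coordGL2_mul_on_bilinear_r x y).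
have D x y u v : tlift (coordGL2_mul_on x y) (u + v) =
    tlift (coordGL2_mul_on x y) u + tlift (coordGL2_mul_on x y) v.
  by have := L x y 1 u v; rewrite !scale1r.
have Z x y : tlift (coordGL2_mul_on x y) 0 = 0.
  by have /eqP := D x y 0 0; rewrite addr0 -subr_eq subrr eq_sym => /eqP.
have P x y w z := tlift_pure (coordGL2_mul_on_bilinear_r x y) w z.
split=> [y c x x'|x c y y'].
- elim/tensor_ind: t => [w z||u v IHu IHv].
  + by rewrite !P; case: (coordGL2_mul_on_bilinear_l w z) => + _; apply.
  + by rewrite !Z scaler0 addr0.
  + by rewrite !D IHu IHv scalerDr addrACA.
- elim/tensor_ind: t => [w z||u v IHu IHv].
  + by rewrite !P; case: (coordGL2_mul_on_bilinear_l w z) => _; apply.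
  + by rewrite !Z scaler0 addr0.
  + by rewrite !D IHu IHv scalerDr addrACA.
Qed.

Lemma coordGL2_mul_pure b c (x y w z : H) :
    homogeneous b y -> homogeneous c w ->
  coordGL2_mul (x ⊗ y) (w ⊗ z) = (-1) ^+ (b && c) *: ((x * w) ⊗ (y * z)).
Proof.
move=> yb wc; rewrite /coordGL2_mul.
rewrite (tlift_pure (coordGL2_mul_bilinear _)).
rewrite (tlift_pure (coordGL2_mul_on_bilinear_r x y)) /coordGL2_mul_on.
rewrite (bigD1 b) //= (bigD1 c) //= yb wc !big1 ?addr0 // => [b' bb'|c' cc'].
  rewrite big1 // => c' _; rewrite -yb spart_idem (negPf bb') mul0r.
  by rewrite pure0r scaler0.
by rewrite -wc spart_idem (negPf cc') mulr0 pure0l scaler0.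
Qed.

Definition is_comultiplication (Delta : H -> H ⊗ H) : Prop :=
  [/\ linear Delta,
      forall b x, Delta (spart b x) = spart b (Delta x),
      Delta 1 = 1 ⊗ 1,
      forall x y, Delta (x * y) = coordGL2_mul (Delta x) (Delta y)
    & forall i j, Delta (coordX k i j) = \sum_l coordX k i l ⊗ coordX k l j].

Definition is_counit (eps : H -> k) : Prop :=
  [/\ scalar eps,
      forall x, eps (spart true x) = 0,
      eps 1 = 1,
      forall x y, eps (x * y) = eps x * eps y
    & forall i j, eps (coordX k i j) = (i == j)%:R].

Definition coordX_mx : 'M[H]_(m + n) := \matrix_(i, j) coordX k i j.

Definition is_inverse_mx (Y : 'M[H]_(m + n)) : Prop :=
  coordX_mx *m Y = 1%:M /\ Y *m coordX_mx = 1%:M.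

End HopfStructure.


Definition kspan (k : fieldType) (A : lmodType k) (P : A -> Prop) (a : A) :=
  exists s : seq (k * A),
    (forall p, p \in s -> P p.2) /\ a = \sum_(p <- s) p.1 *: p.2.

Section RationalDegree.
Variables (k : fieldType) (m n : nat).
Local Notation H := (coordGL k m n).
Variable xt : 'M[H]_(m + n).

Definition mixed_monomial (r s : nat) (h : H) : Prop :=
  exists (i j : 'I_(m + n) ^ r) (i' j' : 'I_(m + n) ^ s),
    h = \prod_(a < r) coordX k (i a) (j a) * \prod_(b < s) xt (i' b) (j' b).

Definition mixed_coef (r s : nat) : H -> Prop := kspan (mixed_monomial r s).

Definition rational_coef (z : int) (h : H) : Prop :=
  match z with
  | Posz p => exists t, mixed_coef (p + t) t h
  | Negz p => exists t, mixed_coef t (p.+1 + t) h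
  end.

End RationalDegree.


Section Supermodules.
Variables (k : fieldType) (m n : nat).
Local Notation H := (coordGL k m n).

Definition is_supercomodule (Delta : H -> H ⊗ H) (eps : H -> k)
    (V : superType k) (tau : V -> V ⊗ H) : Prop :=
  [/\ linear tau,
      forall b v, tau (spart b v) = spart b (tau v),
      forall v, tassoc (tmap tau id (tau v)) = tmap id Delta (tau v)
    & forall v, tlift (fun u h => eps h *: u) (tau v) = v].

Variables (V : superVectType k) (tau : V -> V ⊗ H).

Definition is_subsupermodule (W : {vspace V}) : Prop :=
  (forall b v, v \in W -> spart b v \in W) /\
  (forall v, v \in W -> exists s : seq (V * H),
     (forall p, p \in s -> p.1 \in W) /\ tau v = \sum_(p <- s) p.1 ⊗ p.2).

(* The coefficient space of the subsupermodule W, with respect to some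
   homogeneous basis of W (it does not depend on the basis). *)
Definition cf (W : {vspace V}) (h : H) : Prop :=
  exists (w : (\dim W).-tuple V) (a : 'M[H]_(\dim W)),
    [/\ basis_of W w,
        forall i, exists b, homogeneous b (tnth w i),
        forall j, tau (tnth w j) = \sum_i tnth w i ⊗ a i j
      & kspan (fun g => exists i j, g = a i j) h].

Variable xt : 'M[H]_(m + n).

Definition has_rational_degree (W : {vspace V}) (z : int) : Prop :=
  forall h, cf W h -> rational_coef xt z h.

Definition has_bidegree (W : {vspace V}) (r s : nat) : Prop :=
  (forall h, cf W h -> mixed_coef xt r s h) /\
  ((0 < r)%N -> (0 < s)%N ->
     ~ (forall h, cf W h -> mixed_coef xt r.-1 s.-1 h)).

(* U is the union of the ascending chain of the W t, where W t has bidegree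
   (r + t, s + t).  A finite-dimensional chain cannot grow forever while the
   second half of [has_bidegree] excludes the lower bidegree, so the bidegree
   is asked for at the start and wherever the chain grows. *)
Definition is_bidegree_chain (U : {vspace V}) (r s : nat)
    (W : nat -> {vspace V}) : Prop :=
  [/\ forall t, is_subsupermodule (W t),
      forall t, (W t <= W t.+1)%VS,
      has_bidegree (W 0%N) r s,
      forall t, W t.+1 <> W t -> has_bidegree (W t.+1) (r + t.+1) (s + t.+1)
    & forall v, v \in U <-> exists t, v \in W t].

End Supermodules.

Definition is_direct_sum (k : fieldType) (V : vectType k) (I : eqType)
    (U : I -> {vspace V}) : Prop :=
  (forall v, exists (s : seq I) (f : I -> V),
     [/\ uniq s, forall i, f i \in U i & v = \sum_(i <- s) f i]) /\
  (forall (s : seq I) (f : I -> V), uniq s -> (forall i, f i \in U i) ->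
     \sum_(i <- s) f i = 0 -> forall i, i \in s -> f i = 0).

(* Main.v *)
Require Import Defs.
From HB Require Import structures.
From mathcomp Require Import all_boot all_order all_fingroup all_algebra.
From mathcomp Require Import boolp classical_sets zify.
From mathcomp Require generic_quotient.

Set Implicit Arguments.
Unset Strict Implicit.
Unset Printing Implicit Defensive.

Import Order.TTheory GRing.Theory Num.Theory.
Local Open Scope ring_scope.

(* Write H = k[GL(m|n)].  First, H is generated by the entries of X and of its
   inverse xt: modulo odd elements, the diagonal blocks of xt are inverse to
   those of X, so that d1 d2 times the product of the determinants of the
   diagonal blocks of xt is 1 minus a nilpotent, and a geometric series expresses
   (d1 d2)^-1.  Hence H is the sum of the subcoalgebras C_z, the spans of the
   products of r entries of X and s entries of xt with r - s = z.

   The dual of H acts on V through lam . v = (id ⊗ lam)(tau v).  For a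
   subcoalgebra C, the vectors v with tau v in V ⊗ C are those annihilated by all
   the functionals vanishing on C, and they form a subsupermodule; V_z and the
   members of its chain are of this form.  The projection of V onto V_z is the
   action of a functional equal to the counit on C_z and to 0 on the C_y, y <> z;
   in bounded degrees, it is a combination of the morphisms sending X to a scalar
   matrix c, by inverting a Vandermonde matrix. *)

(** * Supercommutativity of k[GL(m|n)] and parity of the inverse matrix *)

Section Supercommutativity.
Variables (k : fieldType) (m n : nat).
Local Notation H := (coordGL k m n).

Lemma spart_coordX b i j :
  spart b (coordX k i j : H) = if ipar i (+) ipar j == b then coordX k i j else 0.
Proof. exact: (coordGL_spart_class b (GlVar k i j)). Qed.

Lemma spart_alg b (c : k) : spart b (c%:A : H) = if b then 0 else c%:A.
Proof. by rewrite -[in LHS]glclass_cst; apply: (coordGL_spart_class b (GlCst m n c)). Qed.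

Lemma spart1 b : spart b (1 : H) = if b then 0 else 1.
Proof. by have := spart_alg b 1; rewrite scale1r. Qed.

Lemma spart_dinv b :
  spart b (coord_dinv k m n) = if b then 0 else coord_dinv k m n.
Proof. exact: (coordGL_spart_class b (GlInv k m n)). Qed.

Lemma spartM b (x y : H) : spart b (x * y) =
  spart false x * spart b y + spart true x * spart (~~ b) y.
Proof. exact: coordGL_spartM. Qed.

(** Quantifying over the components of both arguments gives a condition on arbitrary elements that
    is stable under sums and products. *)
Definition supercommute (x y : H) := forall b c,
  spart b x * spart c y = (-1) ^+ (b && c) *: (spart c y * spart b x).

Lemma supercommute_sym x y : supercommute x y -> supercommute y x.
Proof. by move=> xy b c; rewrite xy andbC scalerA -signr_addb addbb scale1r. Qed.

Lemma supercommute_alg c y : supercommute c%:A y.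
Proof.
move=> [] c'; rewrite spart_alg ?mul0r ?mulr0 ?scaler0 //=.
by rewrite scale1r mulr_algl mulr_algr.
Qed.

Lemma supercommuteD x x' y :
  supercommute x y -> supercommute x' y -> supercommute (x + x') y.
Proof. by move=> xy xy' b c; rewrite linearD mulrDl xy xy' mulrDr scalerDr. Qed.

Lemma supercommuteM x x' y :
  supercommute x y -> supercommute x' y -> supercommute (x * x') y.
Proof.
move=> xy xy' b c; rewrite spartM mulrDl mulrDr -!mulrA !xy'.
rewrite -!scalerAr !mulrA !xy -!scalerAl scalerDr !scalerA; congr (_ + _);
  by case: b; case: c; rewrite //= ?expr0 ?expr1 ?mulN1r ?mulrN1 ?mulr1 ?opprK.
Qed.

Lemma supercommute_sum I (r : seq I) (P : pred I) (F : I -> H) y :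
  (forall i, supercommute (F i) y) -> supercommute (\sum_(i <- r | P i) F i) y.
Proof.
move=> Fy; elim/big_ind: _ => // [|? ? *]; last exact: supercommuteD.
by rewrite -(scale0r 1); apply: supercommute_alg.
Qed.

Lemma supercommute_prod I (r : seq I) (P : pred I) (F : I -> H) y :
  (forall i, supercommute (F i) y) -> supercommute (\prod_(i <- r | P i) F i) y.
Proof.
move=> Fy; elim/big_ind: _ => // [|? ? *]; last exact: supercommuteM.
by rewrite -(scale1r 1); apply: supercommute_alg.
Qed.

Lemma supercommute_det p (A : 'M[H]_p) y :
  (forall i j, supercommute (A i j) y) -> supercommute (\det A) y.
Proof.
move=> Ay; apply: supercommute_sum => s; apply: supercommuteM.
  by rewrite -scalar_sign; apply: supercommute_alg.
exact: supercommute_prod.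
Qed.

Lemma coordX_supercommute i j l p : supercommute (coordX k i j) (coordX k l p).
Proof.
move=> b c; rewrite !spart_coordX.
case: eqP => [<-|_]; last by rewrite mul0r mulr0 scaler0.
case: eqP => [<-|_]; last by rewrite mul0r mulr0 scaler0.
by rewrite coordX_supercomm -[in LHS]scalar_sign mulr_algl.
Qed.

Lemma spart_det_even p (A : 'M[H]_p) :
  (forall i j, spart true (A i j) = 0) -> spart true (\det A) = 0.
Proof.
move=> A0; have M0 (x y : H) :
  spart true x = 0 -> spart true y = 0 -> spart true (x * y) = 0.
  by move=> x0 y0; rewrite spartM x0 y0 mulr0 mul0r addr0.
rewrite linear_sum big1 // => s _; apply: (M0).
  by rewrite -scalar_sign spart_alg.
apply: (big_ind (fun x : H => spart true x = 0)) => [|x y|i _]; 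
  [by rewrite spart1|exact: M0|exact: A0].
Qed.

Lemma supercommute_d y :
  (forall i j, supercommute (coordX k i j) y) ->
  supercommute (coord_d1 k m n * coord_d2 k m n) y.
Proof.
move=> Xy; apply: supercommuteM; apply: supercommute_det => i j; rewrite mxE;
  exact: Xy.
Qed.

Lemma spart_d1 : spart true (coord_d1 k m n) = 0.
Proof.
by apply: spart_det_even => i j; rewrite mxE spart_coordX !ipar_lshift.
Qed.

Lemma spart_d2 : spart true (coord_d2 k m n) = 0.
Proof.
by apply: spart_det_even => i j; rewrite mxE spart_coordX !ipar_rshift.
Qed.

Lemma even_spart (x : H) : spart true x = 0 -> spart false x = x.
Proof. by move=> x1; rewrite -[RHS]spart_sum x1 addr0. Qed.

(** The product d1 d2 is even, so it commutes strictly with each component of [y]; multiplying by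
    its inverse on both sides transfers this to the inverse. *)
Lemma supercommute_dinv y :
  (forall i j, supercommute (coordX k i j) y) -> supercommute (coord_dinv k m n) y.
Proof.
move=> /supercommute_d; set d := _ * _ => dy [] c; rewrite spart_dinv.
  by rewrite mul0r mulr0 scaler0.
have d1 : spart true d = 0.
  by rewrite spartM spart_d1 spart_d2 mulr0 mul0r addr0.
have := dy false c; rewrite !scale1r (even_spart d1) => cdy.
rewrite -[LHS]mulr1 -(coord_dinvr k m n) -/d mulrA -(mulrA _ _ d) -cdy.
by rewrite mulrA coord_dinvl mul1r.
Qed.

Lemma coordGL_supercommute x y : supercommute x y.
Proof.
(* Induction on terms reduces one argument to a generator; by symmetry the same reduction then
   applies to the other argument. *)
have from_gens z : (forall i j, supercommute (coordX k i j) z) ->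
    forall w, supercommute w z.
  move=> Xz; elim/glclassW; elim=> [c|i j||s IHs t IHt|s IHs t IHt].
  - by rewrite glclass_cst; apply: supercommute_alg.
  - exact: Xz.
  - exact: supercommute_dinv.
  - by rewrite -glclass_add; apply: supercommuteD.
  - by rewrite -glclass_mul; apply: supercommuteM.
apply: (from_gens) => i j; apply: supercommute_sym; apply: (from_gens) => l p.
exact: coordX_supercommute.
Qed.

Lemma homogeneous_comm b c (x y : H) : homogeneous b x -> homogeneous c y ->
  x * y = (-1) ^+ (b && c) *: (y * x).
Proof. by move=> bx cy; have := coordGL_supercommute x y b c; rewrite bx cy. Qed.

Lemma homogeneousM b c (x y : H) : homogeneous b x -> homogeneous c y ->
  homogeneous (b (+) c) (x * y).
Proof.
move=> bx cy; rewrite /homogeneous spartM -bx -cy !spart_idem.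
by case: b bx; case: c cy => _ _ /=; rewrite ?mulr0 ?mul0r ?addr0 ?add0r.
Qed.

Lemma homogeneous_coordX i j : homogeneous (ipar i (+) ipar j) (coordX k i j : H).
Proof. by rewrite /homogeneous spart_coordX eqxx. Qed.

Lemma odd_sqr0 (x : H) : 2%N \notin [pchar k] -> homogeneous true x -> x * x = 0.
Proof.
move=> char_k ox; have := homogeneous_comm ox ox.
rewrite scaleN1r => /eqP; rewrite -subr_eq0 opprK -mulr2n -scaler_nat.
by rewrite scaler_eq0 => /orP[two0|/eqP//]; case/negP: char_k; rewrite inE two0.
Qed.

Variable xt : 'M[H]_(m + n).
Hypothesis xt_inv : is_inverse_mx xt.

Lemma mulX_xt i j : \sum_l coordX k i l * xt l j = (i == j)%:R.
Proof.
have [/matrixP/(_ i j) + _] := xt_inv; rewrite !mxE => <-.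
by apply: eq_bigr => l _; rewrite mxE.
Qed.

(** Taking the component of the expected parity in each entry of X [xt] = 1 shows that the matrix
    [Z] of components is also a right inverse of X, and inverses are unique. *)
Lemma homogeneous_xt i j : homogeneous (ipar i (+) ipar j) (xt i j).
Proof.
pose Z : 'M[H]_(m + n) := \matrix_(i, j) spart (ipar i (+) ipar j) (xt i j).
suff -> : xt = Z by rewrite /homogeneous mxE spart_idem eqxx.
have [XY YX] := xt_inv.
suff XZ : coordX_mx k m n *m Z = 1%:M by rewrite -[LHS]mulmx1 -XZ mulmxA YX mul1mx.
apply/matrixP => a b; rewrite !mxE.
have := congr1 (spart (ipar a (+) ipar b)) (mulX_xt a b).
rewrite linear_sum /= => E.
rewrite [RHS](_ : _ = spart (ipar a (+) ipar b) ((a == b)%:R : H)).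
  rewrite -E; apply: eq_bigr => l _; rewrite !mxE spartM !spart_coordX.
  case: (ipar a); case: (ipar b); case: (ipar l) => /=;
    by rewrite ?mul0r ?add0r ?addr0.
have [->|_] := eqVneq a b; first by rewrite addbb spart1.
by rewrite linear0.
Qed.

End Supercommutativity.

(** * Nilpotent elements of a commutative ring *)

Section Nilpotent.
Variable R : comNzRingType.
Implicit Types x y : R.

Definition nilpotent_elt x := exists p, x ^+ p = 0.

Lemma nilpotent0 : nilpotent_elt 0.
Proof. by exists 1%N. Qed.

Lemma nilpotentD x y : nilpotent_elt x -> nilpotent_elt y -> nilpotent_elt (x + y).
Proof.
move=> [p xp] [q yq]; exists (p + q)%N; rewrite exprDn big1 // => i _.
have [qi|iq] := leqP q i; first by rewrite -(subnK qi) exprD yq !mulr0 mul0rn.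
rewrite -(subnK (_ : p <= p + q - i)%N); first by rewrite exprD xp mulr0 mul0r mul0rn.
by rewrite -addnBA ?leq_addr // ltnW.
Qed.

Lemma nilpotentMl x y : nilpotent_elt y -> nilpotent_elt (x * y).
Proof. by move=> [p yp]; exists p; rewrite exprMn yp mulr0. Qed.

Lemma nilpotent_sum I (r : seq I) (F : I -> R) :
  (forall i, nilpotent_elt (F i)) -> nilpotent_elt (\sum_(i <- r) F i).
Proof.
move=> NF; apply: big_ind => //; [exact: nilpotent0|exact: nilpotentD].
Qed.

(** Nilpotent elements form an ideal, and entries congruent modulo an ideal have congruent products.
    The induction replaces one factor at a time. *)
Lemma nilpotent_det p (A B : 'M[R]_p) :
  (forall i j, nilpotent_elt (A i j - B i j)) -> nilpotent_elt (\det A - \det B).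
Proof.
move=> NAB; rewrite /determinant -sumrB; apply: nilpotent_sum => s.
rewrite -mulrBr; apply: nilpotentMl.
elim/big_rec2: _ => [|i x y _ Nxy]; first by rewrite subrr; apply: nilpotent0.
have -> : A i (s i) * y - B i (s i) * x =
    A i (s i) * (y - x) + x * (A i (s i) - B i (s i)).
  by rewrite !mulrBr [x * A _ _]mulrC addrA subrK [x * B _ _]mulrC.
by apply: nilpotentD; apply: nilpotentMl => //; rewrite -opprB -mulN1r; apply: nilpotentMl.
Qed.

End Nilpotent.

(** * The even part of k[GL(m|n)] and the inverse of d1 d2 *)

Section EvenPart.
Variables (k : fieldType) (m n : nat).
Local Notation H := (coordGL k m n).

Definition even_coord : {pred H} := [pred x : H | spart true x == 0].

Fact even_coord_subring : subring_closed even_coord.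
Proof.
split=> [|x y|x y]; rewrite !unfold_in; first by rewrite spart1.
  by move=> /eqP x0 /eqP y0; rewrite linearB /= x0 y0 subrr.
by move=> /eqP x0 /eqP y0; rewrite spartM x0 y0 mulr0 mul0r addr0.
Qed.
HB.instance Definition _ :=
  GRing.isSubringClosed.Build H even_coord even_coord_subring.

(** As a commutative ring, the even part has multiplicative determinants and admits the nilpotence
    lemmas above. *)
Record evenGL := EvenGL { even_val : H; even_valP : even_val \in even_coord }.
HB.instance Definition _ := [isSub for even_val].
HB.instance Definition _ := [Choice of evenGL by <:].
HB.instance Definition _ := [SubChoice_isSubNzRing of evenGL by <:].

Fact evenGL_mulC : commutative (@GRing.mul evenGL).
Proof.
move=> x y; apply: val_inj; rewrite !rmorphM /=.
have ev (z : evenGL) : homogeneous false (val z).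
  by apply: even_spart; apply/eqP; have := valP z; rewrite inE.
by rewrite (homogeneous_comm (ev x) (ev y)) scale1r.
Qed.
HB.instance Definition _ := GRing.PzRing_hasCommutativeMul.Build evenGL evenGL_mulC.


Lemma homogeneous_even (x : H) : homogeneous false x -> x \in even_coord.
Proof. by move=> hx; rewrite inE -hx spart_idem. Qed.

Hypothesis char_k : 2%N \notin [pchar k].

(* Odd elements square to zero, so a product of two of them does as well. *)
Lemma nilpotent_sum_odd p (o q : 'I_p -> H) (e : evenGL) :
    (forall l, homogeneous true (o l)) -> (forall l, homogeneous true (q l)) ->
  val e = \sum_l o l * q l -> nilpotent_elt e.
Proof.
move=> oo oq eE; have ev l := homogeneous_even (homogeneousM (oo l) (oq l)).
have -> : e = \sum_l EvenGL (ev l).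
  by apply: val_inj; rewrite rmorph_sum.
apply: nilpotent_sum => l; exists 2%N; apply: val_inj; rewrite rmorphXn /= expr2.
rewrite -mulrA (mulrA (q l)) (homogeneous_comm (oq l) (oo l)) scaleN1r mulNr.
by rewrite mulrN !mulrA odd_sqr0 // !mul0r oppr0.
Qed.

Variable xt : 'M[H]_(m + n).
Hypothesis xt_inv : is_inverse_mx xt.

(* [e] selects one of the two diagonal blocks, of parity [b], and [e'] the
   other one: modulo odd elements the block of [xt] inverts that of X. *)
Lemma diag_block_nilpotent b p p' (e : 'I_p -> 'I_(m + n)) (e' : 'I_p' -> 'I_(m + n)) :
    (forall i, ipar (e i) = b) -> (forall i, ipar (e' i) = ~~ b) -> injective e ->
    (forall F : 'I_(m + n) -> H, \sum_l F l = \sum_l F (e l) + \sum_l F (e' l)) ->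
  exists x y z : evenGL,
    [/\ val x = \det (\matrix_(i, j) coordX k (e i) (e j)),
        val y = \det (\matrix_(i, j) xt (e i) (e j)),
        x * y = 1 - z & nilpotent_elt z].
Proof.
move=> eb e'b e_inj sumE.
have evX i j : coordX k (e i) (e j) \in even_coord.
  by apply: homogeneous_even; have := homogeneous_coordX k (e i) (e j); rewrite !eb addbb.
have evY i j : xt (e i) (e j) \in even_coord.
  by apply: homogeneous_even; have := homogeneous_xt xt_inv (e i) (e j); rewrite !eb addbb.
pose X := \matrix_(i, j) EvenGL (evX i j); pose Y := \matrix_(i, j) EvenGL (evY i j).
exists (\det X), (\det Y), (1 - \det X * \det Y); split.
- by rewrite -[LHS](det_map_mx val X); congr (\det _); apply/matrixP => i j; rewrite !mxE.
- by rewrite -[LHS](det_map_mx val Y); congr (\det _); apply/matrixP => i j; rewrite !mxE.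
- by rewrite opprB addrC subrK.
rewrite -det_mulmx -(det1 _ p); apply: nilpotent_det => i j.
apply: (@nilpotent_sum_odd p' (fun l => coordX k (e i) (e' l)) (fun l => xt (e' l) (e j))).
- by move=> l; have := homogeneous_coordX k (e i) (e' l); rewrite eb e'b; case: b {eb e'b}.
- by move=> l; have := homogeneous_xt xt_inv (e' l) (e j); rewrite eb e'b; case: b {eb e'b}.
have := mulX_xt xt_inv (e i) (e j); rewrite sumE (inj_eq e_inj) !mxE => E.
rewrite rmorphB rmorph_nat -E rmorph_sum /=.
have -> : \sum_(l < p) even_val (X i l) * even_val (Y l j) =
    \sum_(l < p) coordX k (e i) (e l) * xt (e l) (e j).
  by apply: eq_bigr => l _; rewrite !mxE.
by rewrite addrAC subrr add0r.
Qed.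

(** With z = 1 - d1 d2 y nilpotent, the geometric sum of the powers of z inverts d1 d2 y, so y times
    this sum inverts d1 d2. The even and the odd diagonal block together give the nilpotence of
    z. *)
Lemma coord_dinv_xt : exists (p : nat),
  let y := \det (\matrix_(i < m, j < m) xt (lshift n i) (lshift n j)) *
    \det (\matrix_(i < n, j < n) xt (rshift m i) (rshift m j)) in
  coord_dinv k m n = y * \sum_(i < p) (1 - coord_d1 k m n * coord_d2 k m n * y) ^+ i.
Proof.
have [|||F|x1 [y1 [z1 [x1E y1E xy1 nz1]]]] :=
    @diag_block_nilpotent false m n (@lshift m n) (@rshift m n).
- exact: ipar_lshift.
- exact: ipar_rshift.
- exact: lshift_inj.
- exact: big_split_ord.
have [|||F|x2 [y2 [z2 [x2E y2E xy2 nz2]]]] :=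
    @diag_block_nilpotent true n m (@rshift m n) (@lshift m n).
- exact: ipar_rshift.
- exact: ipar_lshift.
- exact: rshift_inj.
- by rewrite big_split_ord addrC.
have [p zp] : nilpotent_elt (1 - x1 * x2 * (y1 * y2)).
  have -> : 1 - x1 * x2 * (y1 * y2) = z1 + (1 - z1) * z2.
    by rewrite mulrACA xy1 xy2 mulrBr mulr1 !opprB addrCA (addrC 1) subrK addrC.
  by apply: nilpotentD => //; apply: nilpotentMl.
exists p => /=; rewrite -y1E -y2E.
have -> : coord_d1 k m n = val x1 by rewrite x1E.
have -> : coord_d2 k m n = val x2 by rewrite x2E.
have dE : coord_dinv k m n * even_val x1 * even_val x2 = 1.
  by rewrite -mulrA; move: x1E x2E => /= -> ->; apply: coord_dinvl.
have : val (1 - x1 * x2 * (y1 * y2)) ^+ p = 0 by rewrite -rmorphXn zp rmorph0.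
rewrite rmorphB rmorph1 !rmorphM /=; set z := 1 - _ => zp0.
have := subrX1 z p; rewrite zp0 add0r => /(congr1 (fun x => - coord_dinv k m n * x)).
rewrite mulrNN mulr1 => ->; rewrite mulNr -mulrN -mulNr opprB.
rewrite [1 - z]subKr !mulrA. by rewrite dE mul1r.
Qed.

End EvenPart.

(** * Subspaces given by predicates, and spans *)

Section Kspan.
Variables (k : fieldType) (A : lmodType k).
Implicit Types (P Q : A -> Prop) (a b : A).

Definition is_subspace P :=
  [/\ P 0, forall a b, P a -> P b -> P (a + b) & forall c a, P a -> P (c *: a)].

Lemma subspace_sum P I (r : seq I) (F : I -> A) :
  is_subspace P -> (forall i, P (F i)) -> P (\sum_(i <- r) F i).
Proof. by move=> [P0 PD _] PF; apply: big_ind => // i _. Qed.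

Lemma kspan_subspace P : is_subspace (kspan P).
Proof.
split=> [|a b [s [Ps ->]] [t [Pt ->]]|c a [s [Ps ->]]].
- by exists [::]; rewrite big_nil.
- exists (s ++ t); rewrite big_cat; split=> // p.
  by rewrite mem_cat => /orP[/Ps|/Pt].
- exists [seq (c * p.1, p.2) | p <- s]; split=> [p /mapP[q /Ps Pq ->]//|].
  by rewrite big_map scaler_sumr; apply: eq_bigr => p _; rewrite scalerA.
Qed.

Lemma kspan_gen P a : P a -> kspan P a.
Proof.
move=> Pa; exists [:: (1, a)]; rewrite big_seq1 scale1r; split=> // p.
by rewrite inE => /eqP->.
Qed.

Lemma kspan_sub P Q a : is_subspace Q -> (forall b, P b -> Q b) -> kspan P a -> Q a.
Proof.
move=> [Q0 QD QZ] PQ [s [Ps ->]]; rewrite big_seq_cond.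
by apply: big_ind => // p /andP[/Ps /PQ Qp _]; apply: QZ.
Qed.

End Kspan.

(** * Coefficients graded by the numbers of entries of X and of its inverse *)

Section Words.
Variables (k : fieldType) (m n : nat).
Local Notation H := (coordGL k m n).
Variable xt : 'M[H]_(m + n).

(* The span of the products of [r - t] entries of X and [s - t] entries of
   [xt], in any order and for all [t].  It is [mixed_coef xt r s] unless
   [m + n = 0] (see [mcoef_mixed]), where [mixed_coef xt r r] vanishes for
   [0 < r]; the constructor [mcoef1] makes it increasing in all cases. *)
Inductive mcoef : nat -> nat -> H -> Prop :=
  | mcoef0 r s : mcoef r s 0
  | mcoefD r s x y : mcoef r s x -> mcoef r s y -> mcoef r s (x + y)
  | mcoefZ r s c x : mcoef r s x -> mcoef r s (c *: x)
  | mcoef1 r : mcoef r r 1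
  | mcoefX i j : mcoef 1 0 (coordX k i j)
  | mcoefT i j : mcoef 0 1 (xt i j)
  | mcoefM r s r' s' x y : mcoef r s x -> mcoef r' s' y ->
      mcoef (r + r') (s + s') (x * y).

Lemma mcoef_subspace r s : is_subspace (mcoef r s).
Proof. split; [exact: mcoef0|exact: mcoefD|exact: mcoefZ]. Qed.

Lemma mcoef_add r s t x : mcoef r s x -> mcoef (r + t) (s + t) x.
Proof. by move=> rsx; rewrite -[x]mulr1; apply: mcoefM rsx (mcoef1 t). Qed.

(** The subcoalgebra C_z of the overview, for both signs of z at once. *)
Definition deg_coef (z : int) (h : H) : Prop :=
  exists r s, r%:Z - s%:Z = z /\ mcoef r s h.

(** When [r] or [s] is 0, [(r, s)] is the least pair of natural numbers with its difference, so
    every other such pair is [(r + t, s + t)]. *)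
Lemma deg_coefE r s h : (r = 0 \/ s = 0)%N ->
  deg_coef (r%:Z - s%:Z) h <-> exists t, mcoef (r + t) (s + t) h.
Proof.
move=> rs; split=> [[r' [s' [E h']]]|[t ht]]; last first.
  by exists (r + t)%N, (s + t)%N; split=> //; lia.
exists (r' - r)%N; have -> : (r + (r' - r) = r')%N by lia.
by have -> : (s + (r' - r) = s')%N by lia.
Qed.

Lemma deg_coef_subspace z : is_subspace (deg_coef z).
Proof.
split=> [|x y [r [s [<- hx]]] [r' [s' [E hy]]]|c x [r [s [E hx]]]].
- have [z0|z0] := leP 0 z; first by exists `|z|%N, 0%N; split; [lia|exact: mcoef0].
  by exists 0%N, `|z|%N; split; [lia|exact: mcoef0].
- exists (r + r')%N, (s + r')%N; split; first by lia.
  apply: mcoefD; first exact: mcoef_add.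
  have -> : (s + r' = s' + r)%N by lia.
  by rewrite addnC; apply: mcoef_add.
- by exists r, s; split=> //; apply: mcoefZ.
Qed.

Lemma deg_coefM z z' x y : deg_coef z x -> deg_coef z' y -> deg_coef (z + z') (x * y).
Proof.
move=> [r [s [<- hx]]] [r' [s' [<- hy]]]; exists (r + r')%N, (s + s')%N.
by split; [lia|exact: mcoefM].
Qed.

(** The sum of the C_z with |z| <= N. The bound leaves finitely many degrees, which is what
    [degree_functional] can separate. *)
Inductive degle (N : nat) : H -> Prop :=
  | degle_deg z x : (`|z| <= N)%N -> deg_coef z x -> degle N x
  | degleD x y : degle N x -> degle N y -> degle N (x + y).

Lemma degle_leq N N' x : (N <= N')%N -> degle N x -> degle N' x.
Proof.
move=> NN'; elim=> [z {}x zN zx|]; last by move=> *; apply: degleD.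
exact: degle_deg (leq_trans zN NN') zx.
Qed.

Lemma degleM N N' x y : degle N x -> degle N' y -> degle (N + N') (x * y).
Proof.
elim=> {x} [z x zN zx|x x' _ IHx _ IHx' yN]; last first.
  by rewrite mulrDl; apply: degleD; [apply: IHx|apply: IHx'].
elim=> {y} [z' y zN' zy|y y' _ IHy _ IHy']; last by rewrite mulrDr; apply: degleD.
by apply: degle_deg (deg_coefM zx zy); lia.
Qed.

Definition generated x := exists N, degle N x.

Lemma generatedD x y : generated x -> generated y -> generated (x + y).
Proof.
move=> [N xN] [N' yN']; exists (N + N')%N.
by apply: degleD; [apply: degle_leq xN|apply: degle_leq yN']; lia.
Qed.

Lemma generatedM x y : generated x -> generated y -> generated (x * y).
Proof. by move=> [N xN] [N' yN']; exists (N + N')%N; apply: degleM. Qed.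

Lemma mcoef_generated r s x : mcoef r s x -> generated x.
Proof.
by move=> rsx; exists `|r%:Z - s%:Z|%N; apply: degle_deg (leqnn _) _; exists r, s.
Qed.

Lemma generated_alg c : generated c%:A.
Proof. exact: mcoef_generated (mcoefZ c (mcoef1 0)). Qed.

Lemma generated_sum I (r : seq I) (F : I -> H) :
  (forall i, generated (F i)) -> generated (\sum_(i <- r) F i).
Proof.
move=> gF; apply: big_ind => //; last exact: generatedD.
by rewrite -(scale0r 1); apply: generated_alg.
Qed.

Lemma generated_prod I (r : seq I) (F : I -> H) :
  (forall i, generated (F i)) -> generated (\prod_(i <- r) F i).
Proof.
move=> gF; apply: big_ind => //; last exact: generatedM.
by rewrite -(scale1r 1); apply: generated_alg.
Qed.

Lemma generatedX x p : generated x -> generated (x ^+ p).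
Proof.
move=> gx; elim: p => [|p IH]; last by rewrite exprS; apply: generatedM.
by rewrite expr0 -(scale1r 1); apply: generated_alg.
Qed.

Lemma generated_det p (A : 'M[H]_p) :
  (forall i j, generated (A i j)) -> generated (\det A).
Proof.
move=> gA; apply: generated_sum => s; apply: generatedM.
  by rewrite -scalar_sign; apply: generated_alg.
exact: generated_prod.
Qed.

Hypothesis xt_inv : is_inverse_mx xt.

(** The only generator whose degrees are not visible is the inverse of d1 d2, and [coord_dinv_xt]
    writes it as a polynomial in the entries of X and [xt]. *)
Lemma coordGL_generated : 2%N \notin [pchar k] -> forall x, generated x.
Proof.
move=> char_k x.
have gX i j : generated (coordX k i j) by apply: mcoef_generated (mcoefX i j).
have gT i j : generated (xt i j) by apply: mcoef_generated (mcoefT i j).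
have gd : generated (coord_dinv k m n).
  have [p /= ->] := coord_dinv_xt char_k xt_inv; set y := \det _ * \det _.
  have gy : generated y by apply: generatedM; apply: generated_det => i j; rewrite mxE.
  apply: generatedM => //; apply: generated_sum => i.
  apply: generatedX.
  apply: generatedD; first by rewrite -(scale1r 1); apply: generated_alg.
  rewrite -mulN1r -scaleN1r; apply: generatedM; first exact: generated_alg.
  apply: generatedM => //.
  by apply: generatedM; apply: generated_det => a b; rewrite mxE.
elim/glclassW: x; elim=> [c|i j||s IHs t IHt|s IHs t IHt].
- by rewrite glclass_cst; apply: generated_alg.
- exact: gX.
- exact: gd.
- by rewrite -glclass_add; apply: generatedD.
- by rewrite -glclass_mul; apply: generatedM.
Qed.

(** The generators are homogeneous, and the components of a product are sums of products of
    components. *)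
Lemma mcoef_spart b r s x : mcoef r s x -> mcoef r s (spart b x).
Proof.
move=> rsx; elim: rsx b => {r s x}.
- by move=> r s b; rewrite linear0; apply: mcoef0.
- by move=> r s x y _ IHx _ IHy b; rewrite linearD; apply: mcoefD; [exact: IHx|exact: IHy].
- by move=> r s c x _ IHx b; rewrite linearZ; apply: mcoefZ; exact: IHx.
- by move=> r b; rewrite spart1; case: b; [apply: mcoef0|apply: mcoef1].
- by move=> i j b; rewrite spart_coordX; case: ifP => _; [apply: mcoefX|apply: mcoef0].
- move=> i j b; rewrite -(homogeneous_xt xt_inv i j) spart_idem.
  by case: ifP => _; rewrite ?(homogeneous_xt xt_inv); [apply: mcoefT|apply: mcoef0].
- move=> r s r' s' x y _ IHx _ IHy b; rewrite spartM.
  by apply: mcoefD; apply: mcoefM.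
Qed.

Lemma mcoef_prodX r (i j : 'I_r -> 'I_(m + n)) :
  mcoef r 0 (\prod_(a < r) coordX k (i a) (j a)).
Proof.
elim: r i j => [|r IH] i j; first by rewrite big_ord0; apply: mcoef1.
by rewrite big_ord_recl; apply: (mcoefM (mcoefX _ _) (IH _ _)).
Qed.

Lemma mcoef_prodT s (i j : 'I_s -> 'I_(m + n)) :
  mcoef 0 s (\prod_(a < s) xt (i a) (j a)).
Proof.
elim: s i j => [|s IH] i j; first by rewrite big_ord0; apply: mcoef1.
by rewrite big_ord_recl; apply: (mcoefM (mcoefT _ _) (IH _ _)).
Qed.

Lemma mixed_coef_mcoef r s x : mixed_coef xt r s x -> mcoef r s x.
Proof.
apply: kspan_sub => [|_ [i [j [i' [j' ->]]]]]; first exact: mcoef_subspace.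
by have := mcoefM (mcoef_prodX i j) (mcoef_prodT i' j'); rewrite addn0.
Qed.

Lemma homogeneous_prod p (F : 'I_p -> H) :
  (forall i, exists b, homogeneous b (F i)) ->
  exists b, homogeneous b (\prod_(i < p) F i).
Proof.
move=> hF; apply: (big_ind (fun x : H => exists b, homogeneous b x)) => //.
  by exists false; rewrite /homogeneous spart1.
by move=> x y [b hx] [c hy]; exists (b (+) c); apply: homogeneousM.
Qed.

(** Moving the [xt] entries of [x] past the X entries of [y] costs only a sign, as both blocks are
    homogeneous; [b] records that sign. *)
Lemma mixed_monomialM r s r' s' x y :
    mixed_monomial xt r s x -> mixed_monomial xt r' s' y ->
  exists b : bool, mixed_monomial xt (r + r') (s + s') ((-1) ^+ b *: (x * y)).
Proof.
move=> [i [j [i' [j' ->]]]] [l [p [l' [p' ->]]]].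
set X := \prod_(a < r) _; set T := \prod_(b < s) _.
set X' := \prod_(a < r') _; set T' := \prod_(b < s') _.
have [b hT] : exists b, homogeneous b T.
  apply: homogeneous_prod => a; exists (ipar (i' a) (+) ipar (j' a)).
  exact: homogeneous_xt.
have [c hX] : exists b, homogeneous b X'.
  apply: homogeneous_prod => a; exists (ipar (l a) (+) ipar (p a)).
  exact: homogeneous_coordX.
pose join q q' (f : 'I_(m + n) ^ q) (g : 'I_(m + n) ^ q') : 'I_(m + n) ^ (q + q') :=
  [ffun a => match split a with inl a => f a | inr a => g a end].
exists (b && c), (join _ _ i l), (join _ _ j p), (join _ _ i' l'), (join _ _ j' p').
have lE q q' (f : 'I_(m + n) ^ q) (g : 'I_(m + n) ^ q') a : join _ _ f g (lshift q' a) = f a.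
  by rewrite ffunE (unsplitK (inl a)).
have rE q q' (f : 'I_(m + n) ^ q) (g : 'I_(m + n) ^ q') a : join _ _ f g (rshift q a) = g a.
  by rewrite ffunE (unsplitK (inr a)).
have -> : \prod_(a < r + r') coordX k (join _ _ i l a) (join _ _ j p a) = X * X'.
  by rewrite big_split_ord; congr (_ * _); apply: eq_bigr => a _; rewrite ?lE ?rE.
have -> : \prod_(a < s + s') xt (join _ _ i' l' a) (join _ _ j' p' a) = T * T'.
  by rewrite big_split_ord; congr (_ * _); apply: eq_bigr => a _; rewrite ?lE ?rE.
rewrite -mulrA (mulrA T) (homogeneous_comm hT hX) -scalerAl -scalerAr scalerA.
by rewrite -signr_addb addbb scale1r !mulrA.
Qed.

Lemma mixed_coefM r s r' s' x y :
    mixed_coef xt r s x -> mixed_coef xt r' s' y ->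
  mixed_coef xt (r + r') (s + s') (x * y).
Proof.
have [S0 SD SZ] := kspan_subspace (mixed_monomial xt (r + r') (s + s')).
move=> rsx; apply: (@kspan_sub _ _ _ (fun y => mixed_coef xt (r + r') (s + s') (x * y))).
  split=> [|y1 z|c y1]; rewrite ?mulr0 ?mulrDr -?scalerAr; [exact: S0|exact: SD|exact: SZ].
move=> {}y rsy; move: rsx.
apply: (@kspan_sub _ _ _ (fun x => mixed_coef xt (r + r') (s + s') (x * y))).
  split=> [|x' z|c x']; rewrite ?mul0r ?mulrDl -?scalerAl; [exact: S0|exact: SD|exact: SZ].
move=> {}x rsx; have [b /kspan_gen /(SZ ((-1) ^+ b))] := mixed_monomialM rsx rsy.
by rewrite scalerA -signr_addb addbb scale1r.
Qed.

Lemma mixed_coef00 c : mixed_coef xt 0 0 c%:A.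
Proof.
have [_ _ SZ] := kspan_subspace (mixed_monomial xt 0 0).
apply: SZ; apply: kspan_gen.
pose f : 'I_(m + n) ^ 0 := ffun0 (card_ord 0).
by exists f, f, f, f; rewrite !big_ord0 mulr1.
Qed.

Lemma mcoef_mixed r s x : (0 < m + n)%N -> mcoef r s x -> mixed_coef xt r s x.
Proof.
move=> mn0; pose i0 := Ordinal mn0.
have monX i j : mixed_monomial xt 1 0 (coordX k i j).
  pose f : 'I_(m + n) ^ 0 := ffun0 (card_ord 0).
  exists [ffun=> i], [ffun=> j], f, f.
  by rewrite big_ord_recl !big_ord0 !ffunE !mulr1.
have monT i j : mixed_monomial xt 0 1 (xt i j).
  pose f : 'I_(m + n) ^ 0 := ffun0 (card_ord 0).
  exists f, f, [ffun=> i], [ffun=> j].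
  by rewrite big_ord_recl !big_ord0 !ffunE mulr1 mul1r.
elim=> {r s x}.
- by move=> r s; case: (kspan_subspace (mixed_monomial xt r s)).
- by move=> r s x y _ IHx _ IHy; case: (kspan_subspace (mixed_monomial xt r s)) => _ + _; apply.
- by move=> r s c x _ IHx; case: (kspan_subspace (mixed_monomial xt r s)) => _ _; apply.
- elim=> [|r IH]; first by have := mixed_coef00 1; rewrite scale1r.
  rewrite -(addn1 r) -[1 in X in mixed_coef _ _ _ X]mulr1; apply: mixed_coefM => //.
  (* The diagonal entry at [i0] of X [xt] = 1 expresses 1 in bidegree (1, 1); this is where the
     existence of an index enters. *)
  have <- : \sum_l coordX k i0 l * xt l i0 = 1 by rewrite (mulX_xt xt_inv) eqxx.
  apply: subspace_sum => [|l]; first exact: kspan_subspace.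
  by apply: (@mixed_coefM 1 0 0 1); apply: kspan_gen.
- by move=> i j; apply: kspan_gen.
- by move=> i j; apply: kspan_gen.
- by move=> *; apply: mixed_coefM.
Qed.

(** Without indices there are no entries of X or [xt], and only the constants from [mcoef1] remain,
    in equal bidegrees. *)
Lemma mcoef_degenerate r s x : (m + n = 0)%N -> mcoef r s x ->
  x = 0 \/ r = s /\ exists c, x = c%:A.
Proof.
move=> mn0; have noI (i : 'I_(m + n)) : False by case: i; rewrite mn0.
elim=> {r s x}; try by move=> i; case: (noI i).
- by left.
- move=> r s x y _ [->|[-> [c ->]]] _ [->|[E [d ->]]].
  + by left; rewrite addr0.
  + by right; split=> //; exists d; rewrite add0r.
  + by right; split=> //; exists c; rewrite addr0.
  + by right; split=> //; exists (c + d); rewrite scalerDl.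
- move=> r s c x _ [->|[-> [d ->]]]; first by left; rewrite scaler0.
  by right; split=> //; exists (c * d); rewrite scalerA.
- by move=> r; right; split=> //; exists 1; rewrite scale1r.
- move=> r s r' s' x y _ [->|[-> [c ->]]] _ [->|[-> [d ->]]].
  + by left; rewrite mulr0.
  + by left; rewrite mul0r.
  + by left; rewrite mulr0.
  + by right; split=> //; exists (c * d); rewrite mulr_algl scalerA.
Qed.

Lemma mcoef_pred r s x : (m + n = 0)%N -> mcoef r.+1 s.+1 x -> mcoef r s x.
Proof.
move=> mn0 /(mcoef_degenerate mn0)[->|[[->] [c ->]]]; first exact: mcoef0.
exact: mcoefZ (mcoef1 s).
Qed.

(** If m + n = 0, a nonzero [x] forces r = s, so that both are 0, and [mixed_coef] also contains the
    constants in bidegree (0, 0). *)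
Lemma mcoef_mixed_min r s x : (r = 0 \/ s = 0)%N -> mcoef r s x -> mixed_coef xt r s x.
Proof.
move=> rs; have [mn0|] := posnP (m + n); last exact: mcoef_mixed.
have [S0 _ _] := kspan_subspace (mixed_monomial xt r s).
move=> /(mcoef_degenerate mn0)[->//|[rs' [c ->]]].
have [-> ->] : (r = 0 /\ s = 0)%N by lia.
exact: mixed_coef00.
Qed.

Lemma deg_coef_mixed r s x : (r = 0 \/ s = 0)%N -> deg_coef (r%:Z - s%:Z) x ->
  exists t, mixed_coef xt (r + t) (s + t) x.
Proof.
move=> rs /(deg_coefE _ rs)[t xt'].
have [mn0|mn0] := posnP (m + n); last by exists t; apply: mcoef_mixed.
(* If m + n = 0, the bidegree is lowered all the way to (r, s), where [mcoef] and [mixed_coef]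
   agree. *)
exists 0%N; rewrite !addn0; apply: mcoef_mixed_min => //.
elim: t xt' => [|t IH]; first by rewrite !addn0.
by rewrite !addnS => /(mcoef_pred mn0).
Qed.

Lemma deg_coef_rational z x : deg_coef z x -> rational_coef xt z x.
Proof.
case: z => p /= xz.
  have [|t] := @deg_coef_mixed p 0 x (or_intror erefl); first by rewrite subr0.
  by rewrite add0n; exists t.
have [|t] := @deg_coef_mixed 0 p.+1 x (or_introl erefl); first by rewrite sub0r -NegzE.
by rewrite add0n; exists t.
Qed.

End Words.

(** * Separation by linear functionals *)

Section Functionals.
Variables (k : fieldType) (W : lmodType k).

Lemma scalarE (f : W -> k) : scalar f ->
  [/\ f 0 = 0, {morph f : x y / x + y} & forall c, {morph f : x / c *: x >-> c * x}].
Proof.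
move=> lf; have D x y : f (x + y) = f x + f y.
  by have := lf 1 x y; rewrite scale1r mul1r.
have f0 : f 0 = 0 by have /eqP := D 0 0; rewrite addr0 -subr_eq subrr eq_sym => /eqP.
by split=> // c x; have := lf c x 0; rewrite !addr0 f0 addr0.
Qed.

(* By Zorn's lemma there is a subspace M containing C which is maximal among
   those avoiding g; then W = M + k g, and the functional is the g-coordinate. *)
Lemma functional_separation (C : W -> Prop) (g : W) : is_subspace C -> ~ C g ->
  exists lam : W -> k, [/\ scalar lam, forall h, C h -> lam h = 0 & lam g = 1].
Proof.
move=> [C0 CD CZ] nCg.
pose span (X : set W) := kspan (fun w => C w \/ X w).
have [|X [nXg Xmax]] := @Zorn_bigcup W (fun X => ~ span X g).
  move=> F FP totF [s [sP gE]].
  (* A combination involves finitely many vectors, so a single member of the totally ordered family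
     [F] contains all those not taken from [C]; [set0] covers the case where no member is called
     for. *)
  have [Y [FY sY]] : exists Y : set W, (F Y \/ Y = set0) /\
      forall p, p \in s -> C p.2 \/ Y p.2.
    elim: s sP {gE} => [|p s IH] sP; first by exists set0; split=> //; right.
    have [q qs|Y [FY sY]] := IH; first by apply: sP; rewrite inE qs orbT.
    have [Cp|[Z FZ Zp]] := sP p (mem_head _ _).
      by exists Y; split=> // q; rewrite inE => /orP[/eqP->|/sY//]; left.
    case: FY => [FY|Y0].
      have [YZ|ZY] := totF _ _ FY FZ.
        exists Z; split=> [|q]; first by left.
        rewrite inE => /orP[/eqP->|/sY[]]; [by right|by left|by right; exact: YZ].
      exists Y; split=> [|q]; first by left.
      by rewrite inE => /orP[/eqP->|/sY//]; right; exact: ZY.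
    exists Z; split=> [|q]; first by left.
    by rewrite inE => /orP[/eqP->|/sY[]]; [right|left|rewrite Y0].
  case: FY => [/FP|Y0]; first by apply; exists s.
  apply: nCg; rewrite gE big_seq; apply: (big_ind C) => // p /sY[Cp|].
    exact: CZ.
  by rewrite Y0.
have [M0 MD MZ] := kspan_subspace (fun w => C w \/ X w).
have Mdec x : exists c, span X (x - c *: g).
  have [Mx|nMx] := pselect (span X x); first by exists 0; rewrite scale0r subr0.
  (* By maximality, adjoining [x] brings [g] into the span. The coefficient of [x] is nonzero there,
     since [g] was not in the span before, so the relation can be solved for [x]. *)
  have /contrapT [s [sP gE]] : ~ ~ span (X `|` [set x])%classic g.
    apply: Xmax; split=> [y Xy|]; first by left.
    by move=> /(_ x (or_intror erefl)) Xx; apply: nMx; apply: kspan_gen; right.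
  have [c Mc] : exists c, span X (g - c *: x).
    rewrite gE; elim: s sP {gE} => [|p s IH] sP.
      by exists 0; rewrite big_nil scale0r subr0.
    have [q qs|c Mc] := IH; first by apply: sP; rewrite inE qs orbT.
    have [Cp|[Xp|px]] := sP p (mem_head _ _).
    - exists c; rewrite big_cons -addrA; apply: MD => //; apply: MZ.
      by apply: kspan_gen; left.
    - exists c; rewrite big_cons -addrA; apply: MD => //; apply: MZ.
      by apply: kspan_gen; right.
    - by exists (p.1 + c); rewrite big_cons [p.2]px scalerDl opprD addrACA subrr add0r.
  have [c0|c0] := eqVneq c 0; first by move: Mc; rewrite c0 scale0r subr0.
  exists c^-1; have := MZ (- c^-1) _ Mc.
  by rewrite scalerBr scalerA !scaleNr mulNr mulVf // scaleN1r opprK addrC.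
have Muniq c : span X (c *: g) -> c = 0.
  move=> Mcg; apply/eqP; apply: contraPT nXg => c0.
  by have := MZ c^-1 _ Mcg; rewrite scalerA mulVf // scale1r => ?; apply.
pose lam x := sval (cid (Mdec x)).
have lamP x : span X (x - lam x *: g) by rewrite /lam; case: cid.
have lamE x c : span X (x - c *: g) -> lam x = c.
  move=> Mc; apply/eqP; rewrite -subr_eq0; apply/eqP; apply: Muniq.
  have := MD _ _ Mc (MZ (-1) _ (lamP x)).
  by rewrite scaleN1r opprB addrC subrKA scalerBl.
exists lam; split=> [c x y|h Ch|].
- apply: lamE; have := MD _ _ (MZ c _ (lamP x)) (lamP y).
  by rewrite scalerBr addrACA -opprD scalerA -scalerDl.
- by apply: lamE; rewrite scale0r subr0; apply: kspan_gen; left.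
- by apply: lamE; rewrite scale1r subrr; apply: M0.
Qed.

Lemma functional_mem (C : W -> Prop) (h : W) : is_subspace C ->
  (forall lam : W -> k, scalar lam -> (forall x, C x -> lam x = 0) -> lam h = 0) ->
  C h.
Proof.
move=> subC Ch; apply: contrapT => /(functional_separation subC)[lam [lams lamC /eqP]].
by rewrite Ch // eq_sym oner_eq0.
Qed.

End Functionals.

Lemma linear_funE (k : fieldType) (U U' : lmodType k) (f : U -> U') : linear f ->
  [/\ f 0 = 0, {morph f : x y / x + y} & forall c, {morph f : x / c *: x}].
Proof.
move=> lf; have D x y : f (x + y) = f x + f y.
  by have := lf 1 x y; rewrite !scale1r.
have f0 : f 0 = 0 by have /eqP := D 0 0; rewrite addr0 -subr_eq subrr eq_sym => /eqP.
by split=> // c x; have := lf c x 0; rewrite !addr0 f0 addr0.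
Qed.

(** * Tensors tested by functionals on the second factor *)

Section Evaluation.
Variables (k : fieldType) (V : vectType k) (W : lmodType k).
Implicit Types (lam mu : W -> k) (x y : V ⊗ W).

(** The contraction id ⊗ [lam]. *)
Definition evt lam x : V := tlift (fun u h => lam h *: u) x.

Lemma evt_bilinear lam : scalar lam -> bilinear_map (fun (u : V) h => lam h *: u).
Proof.
move=> /scalarE[_ lamD lamZ]; split=> [h c u v|u c h g].
  by rewrite scalerDr !scalerA mulrC.
by rewrite lamD lamZ scalerDl scalerA.
Qed.

Lemma evt_pure lam u h : scalar lam -> evt lam (u ⊗ h) = lam h *: u.
Proof. by move=> /evt_bilinear b; rewrite /evt (tlift_pure b). Qed.

Lemma evt_linear lam : scalar lam -> linear (evt lam).
Proof. by move=> /evt_bilinear b; apply: (tlift_is_linear b). Qed.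

Lemma evt_sum lam I (r : seq I) (F : I -> V ⊗ W) : scalar lam ->
  evt lam (\sum_(i <- r) F i) = \sum_(i <- r) evt lam (F i).
Proof.
by move=> /evt_linear /linear_funE[e0 eD _]; apply: (big_morph _ eD e0).
Qed.

(** For a subspace [C], the hypothesis on the functionals [nu] says that [x] lies in V ⊗ C (see
    [coef_inP]); it is applied to the difference of [lam] and [mu]. *)
Lemma evt_ext lam mu (C : W -> Prop) x : scalar lam -> scalar mu ->
  (forall nu, scalar nu -> (forall h, C h -> nu h = 0) -> evt nu x = 0) ->
  (forall h, C h -> lam h = mu h) -> evt lam x = evt mu x.
Proof.
move=> ls ms Cx lm; apply/eqP; rewrite -subr_eq0.
have [l0 lD lZ] := scalarE ls; have [m0 mD mZ] := scalarE ms.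
have ns : scalar (fun h => lam h - mu h).
  by move=> c h g; rewrite lD mD lZ mZ mulrBr opprD addrACA.
rewrite -(Cx _ ns); last by move=> h /lm ->; rewrite subrr.
have [e0 eD _] := linear_funE (evt_linear ls).
have [f0 fD _] := linear_funE (evt_linear ms).
have [g0 gD _] := linear_funE (evt_linear ns).
apply/eqP; elim/tensor_ind: x {Cx} => [u h||y z IHy IHz].
- by rewrite !evt_pure // scalerBl.
- by rewrite e0 f0 g0 subrr.
- by rewrite eD fD gD opprD addrACA IHy IHz.
Qed.

Local Notation e := (vbasis (@fullv k V)).

Lemma coord_fullv v : v = \sum_(i < \dim (@fullv k V)) coord e i v *: e`_i.
Proof. by apply: coord_vbasis; rewrite memvf. Qed.

Lemma tensor_coords x : exists c : 'I_(\dim (@fullv k V)) -> W,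
  x = \sum_(i < \dim (@fullv k V)) e`_i ⊗ c i.
Proof.
elim/tensor_ind: x => [u h||x y [c ->] [d ->]].
- exists (fun i => coord e i u *: h).
  rewrite {1}[u]coord_fullv.
  transitivity (\sum_(i < \dim (@fullv k V)) (coord e i u *: e`_i) ⊗ h).
    have [P0 PD _] : [/\ (0 : V) ⊗ h = 0, {morph (fun v : V => v ⊗ h) : v w / v + w} & True].
      split=> // [|v w]; last exact: pureDl.
      by rewrite -(scale0r (0 : V)) pureZl scale0r.
    exact: (big_morph _ PD P0).
  by apply: eq_bigr => i _; rewrite pureZl pureZr.
- exists (fun=> 0); rewrite big1 // => i _.
  by rewrite -(scale0r (0 : W)) pureZr scale0r.
- exists (fun i => c i + d i); rewrite -big_split.
  by apply: eq_bigr => i _; rewrite pureDr.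
Qed.

Lemma evt_free p (w : p.-tuple V) (c : 'I_p -> W) lam : scalar lam -> free w ->
  evt lam (\sum_(i < p) w`_i ⊗ c i) = 0 -> forall i, lam (c i) = 0.
Proof.
move=> ls /freeP fw; rewrite evt_sum // => E i.
by apply: (fw (fun i => lam (c i))); rewrite -[RHS]E; apply: eq_bigr => j _; rewrite evt_pure.
Qed.

(** The image of V ⊗ C in V ⊗ W. *)
Definition coef_in (C : W -> Prop) x := exists s : seq (V * W),
  (forall p, p \in s -> C p.2) /\ x = \sum_(p <- s) p.1 ⊗ p.2.

(** For the converse, expand [x] in a basis of V: a functional vanishing on [C] kills every
    coefficient, so the coefficients lie in [C] by [functional_mem]. *)
Lemma coef_inP C x : is_subspace C -> coef_in C x <->
  forall lam, scalar lam -> (forall h, C h -> lam h = 0) -> evt lam x = 0.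
Proof.
move=> subC; split=> [[s [sC ->]] lam ls lC|annx].
  rewrite evt_sum // big_seq big1 // => p /sC Cp.
  by rewrite evt_pure // lC // scale0r.
have [c xE] := tensor_coords x.
have fe : free e := basis_free (vbasisP _).
exists [seq (e`_i, c i) | i : 'I_(\dim (@fullv k V)) <- index_enum _].
rewrite big_map; split=> // p /mapP[i _ ->].
apply: functional_mem => // lam ls lC; apply: (evt_free ls fe).
by rewrite -xE; apply: annx.
Qed.

Lemma coef_in_free C p (w : p.-tuple V) (c : 'I_p -> W) : is_subspace C -> free w ->
  coef_in C (\sum_(i < p) w`_i ⊗ c i) -> forall i, C (c i).
Proof.
move=> subC fw /(coef_inP _ subC) annx i; apply: functional_mem => // lam ls lC.
by apply: (evt_free ls fw); apply: annx.
Qed.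

(** This is [coef_inP] for the zero subspace, applied to x - y. *)
Lemma evt_inj x y : (forall lam, scalar lam -> evt lam x = evt lam y) -> x = y.
Proof.
move=> xy; apply/eqP; rewrite -subr_eq0; apply/eqP.
have subC : is_subspace (fun h : W => h = 0).
  by split=> // [a b -> ->|c a ->]; rewrite ?addr0 ?scaler0.
have /(coef_inP _ subC)[s [s0 ->]] : forall lam, scalar lam ->
    (forall h, h = 0 -> lam h = 0) -> evt lam (x - y) = 0.
  move=> lam ls _; have [_ eD eZ] := linear_funE (evt_linear ls).
  by rewrite -scaleN1r eD eZ scaleN1r xy // subrr.
rewrite big_seq big1 // => p /s0 ->.
by rewrite -(scale0r (0 : W)) pureZr scale0r.
Qed.

End Evaluation.

(** Among the finite-dimensional subspaces inside [P], one of maximal dimension absorbs every vector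
    of [P]. *)
Lemma subspace_vspace (k : fieldType) (V : vectType k) (P : V -> Prop) :
  is_subspace P -> exists U : {vspace V}, forall v, v \in U <-> P v.
Proof.
move=> [P0 PD PZ].
pose Q d := `[< exists U : {vspace V}, \dim U = d /\ forall v, v \in U -> P v >].
have Q0 : exists d, Q d.
  exists 0%N; apply/asboolP; exists 0%VS; split; first exact: dimv0.
  by move=> v; rewrite memv0 => /eqP->.
have Qle d : Q d -> (d <= \dim {:V})%N.
  by move=> /asboolP[U [<- _]]; apply: dimvS; apply: subvf.
case: (ex_maxnP Q0 Qle) => d /asboolP[U [dU UP]] dmax; exists U => v.
split=> [/UP//|Pv]; apply: contrapT => /negP vU.
have /dmax : Q (\dim (U + <[v]>)).
  apply/asboolP; exists (U + <[v]>)%VS; split=> // w /memv_addP[u uU [x /vlineP[c ->] ->]].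
  by apply: PD; [apply: UP|apply: PZ].
rewrite -dU => dle; case/negP: vU.
have /eqP -> : U == (U + <[v]>)%VS by rewrite eqEdim addvSl.
by apply: (subvP (addvSr U <[v]>)); apply: memv_line.
Qed.

(** * The superalgebra H ⊗ H and the comultiplication of mixed coefficients *)

Section SuperTensorSquare.
Variables (k : fieldType) (m n : nat).
Local Notation H := (coordGL k m n).

(* An alias, because the type [H ⊗ H] is not a canonical ring. *)
Definition coordGL2 : Type := tensor H H.
HB.instance Definition _ := GRing.Lmodule.on coordGL2.
Implicit Types s t u : coordGL2.

Lemma coordGL2_mul_linear_l t : linear (fun s : coordGL2 => coordGL2_mul s t).
Proof. exact: (tlift_is_linear (coordGL2_mul_bilinear t)). Qed.

Lemma coordGL2_mul_linear_r s : linear (fun t : coordGL2 => coordGL2_mul s t).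
Proof.
move=> c t u.
elim/tensor_ind: s => [x y||s s' IHs IHs'].
- rewrite /coordGL2_mul !(tlift_pure (coordGL2_mul_bilinear _)).
  exact: (tlift_is_linear (coordGL2_mul_on_bilinear_r x y)).
- have mul0 (v : coordGL2) : coordGL2_mul 0 v = 0 by case: (linear_funE (coordGL2_mul_linear_l v)).
  by rewrite !mul0 scaler0 addr0.
- have mulD (v : coordGL2) : coordGL2_mul (s + s') v =
      coordGL2_mul s v + coordGL2_mul s' v.
    by case: (linear_funE (coordGL2_mul_linear_l v)) => _ + _; apply.
  by rewrite !mulD IHs IHs' scalerDr addrACA.
Qed.

Fact coordGL2_mulDl : left_distributive (@coordGL2_mul k m n) +%R.
Proof.
by move=> s s' t; case: (linear_funE (coordGL2_mul_linear_l t)) => _ + _; apply.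
Qed.

Fact coordGL2_mulDr : right_distributive (@coordGL2_mul k m n) +%R.
Proof.
by move=> s t t'; case: (linear_funE (coordGL2_mul_linear_r s)) => _ + _; apply.
Qed.

Lemma coordGL2_mul0l t : coordGL2_mul 0 t = 0.
Proof. by case: (linear_funE (coordGL2_mul_linear_l t)). Qed.

Lemma coordGL2_mul0r s : coordGL2_mul s 0 = 0.
Proof. by case: (linear_funE (coordGL2_mul_linear_r s)). Qed.

Lemma coordGL2_mulZl c s t : coordGL2_mul (c *: s) t = c *: coordGL2_mul s t.
Proof. by case: (linear_funE (coordGL2_mul_linear_l t)) => _ _; apply. Qed.

Lemma coordGL2_mulZr c s t : coordGL2_mul s (c *: t) = c *: coordGL2_mul s t.
Proof. by case: (linear_funE (coordGL2_mul_linear_r s)) => _ _; apply. Qed.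

Lemma homogeneous_spart b (x : H) : homogeneous b (spart b x).
Proof. by rewrite /homogeneous spart_idem eqxx. Qed.

Lemma homogeneous1 : homogeneous false (1 : H).
Proof. by rewrite /homogeneous spart1. Qed.

(** This reduces identities in H ⊗ H to homogeneous pure tensors, where [coordGL2_mul_pure] computes
    products. *)
Lemma tensor_homogeneous_ind (P : coordGL2 -> Prop) :
    (forall b c (x y : H), homogeneous b x -> homogeneous c y -> P (x ⊗ y)) ->
    P 0 -> (forall s t, P s -> P t -> P (s + t)) -> forall t, P t.
Proof.
move=> Pp P0 PD; apply: tensor_ind => // x y.
rewrite -(spart_sum x) -(spart_sum y) pureDl !pureDr.
by apply: (PD); apply: (PD); apply: (Pp); apply: homogeneous_spart.
Qed.

Fact coordGL2_mulA : associative (@coordGL2_mul k m n).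
Proof.
move=> s t u; elim/tensor_homogeneous_ind: s => [a b x y hx hy||s s' Es Es'].
- elim/tensor_homogeneous_ind: t => [c d w z hw hz||t t' Et Et'].
  + elim/tensor_homogeneous_ind: u => [e f p q hp hq||u u' Eu Eu'].
    * rewrite (coordGL2_mul_pure _ _ hz hp) (coordGL2_mul_pure _ _ hy hw).
      rewrite coordGL2_mulZr coordGL2_mulZl.
      rewrite (coordGL2_mul_pure _ _ hy (homogeneousM hw hp)).
      rewrite (coordGL2_mul_pure _ _ (homogeneousM hy hz) hp).
      rewrite !mulrA !scalerA; congr (_ *: _); rewrite -!signr_addb; congr (_ ^+ _).
      (* Both exponents are |y||w| + |y||p| + |z||p| modulo 2. *)
      by case: b {hy}; case: c {hw}; case: d {hz}; case: e {hp}.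
    * by rewrite !coordGL2_mul0r.
    * by rewrite !coordGL2_mulDr Eu Eu'.
  + by rewrite coordGL2_mul0l coordGL2_mul0r coordGL2_mul0l.
  + by rewrite coordGL2_mulDl !coordGL2_mulDr coordGL2_mulDl Et Et'.
- by rewrite !coordGL2_mul0l.
- by rewrite !coordGL2_mulDl Es Es'.
Qed.

Fact coordGL2_mul1l : left_id (1 ⊗ 1 : coordGL2) (@coordGL2_mul k m n).
Proof.
elim/tensor_homogeneous_ind=> [a b x y hx hy||s s' Es Es'].
- by rewrite (coordGL2_mul_pure _ _ homogeneous1 hx) scale1r !mul1r.
- by rewrite coordGL2_mul0r.
- by rewrite coordGL2_mulDr Es Es'.
Qed.

Fact coordGL2_mul1r : right_id (1 ⊗ 1 : coordGL2) (@coordGL2_mul k m n).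
Proof.
elim/tensor_homogeneous_ind=> [a b x y hx hy||s s' Es Es'].
- by rewrite (coordGL2_mul_pure _ _ hy homogeneous1) andbF scale1r !mulr1.
- by rewrite coordGL2_mul0l.
- by rewrite coordGL2_mulDl Es Es'.
Qed.

HB.instance Definition _ := GRing.Zmodule_isPzRing.Build coordGL2
  coordGL2_mulA coordGL2_mul1l coordGL2_mul1r coordGL2_mulDl coordGL2_mulDr.

Definition tensor_square (C : H -> Prop) : H ⊗ H -> Prop :=
  kspan (fun t => exists x y, [/\ C x, C y & t = x ⊗ y]).

Variables (Delta : H -> H ⊗ H) (xt : 'M[H]_(m + n)).
Hypothesis Delta_comult : is_comultiplication Delta.
Hypothesis xt_inv : is_inverse_mx xt.

(* Delta(X) = (X ⊗ 1)(1 ⊗ X), so its inverse is (1 ⊗ xt)(xt ⊗ 1). *)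
Lemma comult_xt i j : Delta (xt i j) =
  \sum_l (-1) ^+ ((ipar i (+) ipar l) && (ipar l (+) ipar j)) *:
    (xt l j ⊗ xt i l).
Proof.
have [Dlin _ D1 DM DX] := Delta_comult.
have [D0 DD _] := linear_funE Dlin.
have Dsum (F : 'I_(m + n) -> H) : Delta (\sum_l F l) = \sum_l Delta (F l).
  exact: (big_morph _ DD D0).
pose l2 (Y : 'M[H]_(m + n)) : 'M[coordGL2]_(m + n) := \matrix_(i, j) (Y i j ⊗ 1).
pose r2 (Y : 'M[H]_(m + n)) : 'M[coordGL2]_(m + n) := \matrix_(i, j) (1 ⊗ Y i j).
pose D2 (Y : 'M[H]_(m + n)) : 'M[coordGL2]_(m + n) := \matrix_(i, j) Delta (Y i j).
have [XT TX] := xt_inv; set X := coordX_mx k m n in XT TX.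
have mulpl (x y : H) : (x ⊗ 1 : coordGL2) * (y ⊗ 1) = (x * y) ⊗ 1.
  rewrite -(spart_sum y) mulrDr !pureDl [LHS]mulrDr.
  by congr (_ + _); rewrite [LHS](coordGL2_mul_pure _ _ homogeneous1 (homogeneous_spart _ _));
    rewrite scale1r mul1r.
have mulpr (x y : H) : (1 ⊗ x : coordGL2) * (1 ⊗ y) = 1 ⊗ (x * y).
  rewrite -(spart_sum x) mulrDl !pureDr [LHS]mulrDl.
  by congr (_ + _); rewrite [LHS](coordGL2_mul_pure _ _ (homogeneous_spart _ _) homogeneous1);
    rewrite andbF scale1r mul1r.
have sumpl (F : 'I_(m + n) -> H) : \sum_l (F l ⊗ 1 : coordGL2) = (\sum_l F l) ⊗ 1.
  symmetry; apply: (big_morph (fun x : H => x ⊗ 1 : coordGL2)) => [x y|]; last exact: pure0l.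
  exact: pureDl.
have sumpr (F : 'I_(m + n) -> H) : \sum_l (1 ⊗ F l : coordGL2) = 1 ⊗ (\sum_l F l).
  symmetry; apply: (big_morph (fun x : H => 1 ⊗ x : coordGL2)) => [x y|]; last exact: pure0r.
  exact: pureDr.
have l2M Y Z : l2 Y *m l2 Z = l2 (Y *m Z).
  by apply/matrixP => a b; rewrite !mxE -sumpl; apply: eq_bigr => l _; rewrite !mxE mulpl.
have r2M Y Z : r2 Y *m r2 Z = r2 (Y *m Z).
  by apply/matrixP => a b; rewrite !mxE -sumpr; apply: eq_bigr => l _; rewrite !mxE mulpr.
have l21 : l2 1%:M = 1%:M.
  by apply/matrixP => a b; rewrite !mxE; case: (a == b) => //; apply: pure0l.
have r21 : r2 1%:M = 1%:M.
  by apply/matrixP => a b; rewrite !mxE; case: (a == b) => //; apply: pure0r.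
have D2M Y Z : D2 Y *m D2 Z = D2 (Y *m Z).
  apply/matrixP => a b; rewrite !mxE Dsum; apply: eq_bigr => l _.
  by rewrite !mxE DM.
have D21 : D2 1%:M = 1%:M.
  by apply/matrixP => a b; rewrite !mxE; case: (a == b) => //=; rewrite ?D0 ?D1.
have D2X : D2 X = l2 X *m r2 X.
  apply/matrixP => a b; rewrite !mxE DX; apply: eq_bigr => l _; rewrite !mxE.
  rewrite [RHS](coordGL2_mul_pure _ _ homogeneous1 homogeneous1).
  by rewrite scale1r mul1r mulr1.
have D2T : D2 xt = r2 xt *m l2 xt.
  rewrite -[LHS]mulmx1 -l21 -XT -l2M -[l2 X]mulmx1 -r21 -XT -r2M !mulmxA.
  by rewrite -(mulmxA (D2 xt)) -D2X D2M TX D21 mul1mx.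
have := congr1 (fun M : 'M_(m + n) => M i j) D2T; rewrite !mxE => ->.
apply: eq_bigr => l _; rewrite !mxE.
rewrite [LHS](coordGL2_mul_pure _ _ (homogeneous_xt xt_inv i l) (homogeneous_xt xt_inv l j)).
by rewrite mul1r mulr1.
Qed.

Lemma mcoef_comult (r s : nat) x : mcoef xt r s x -> tensor_square (mcoef xt r s) (Delta x).
Proof.
have [Dlin _ D1 DM DX] := Delta_comult.
have [D0 DD DZ] := linear_funE Dlin.
have sub C : is_subspace (tensor_square C) by apply: kspan_subspace.
elim=> {r s x}.
- by move=> r s; rewrite D0; case: (sub (mcoef xt r s)).
- by move=> r s x y _ IHx _ IHy; rewrite DD; case: (sub (mcoef xt r s)) => _ + _; apply.
- by move=> r s c x _ IHx; rewrite DZ; case: (sub (mcoef xt r s)) => _ _; apply.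
- by move=> r; rewrite D1; apply: kspan_gen; exists 1, 1; split=> //; apply: mcoef1.
- move=> i j; rewrite DX; apply: subspace_sum => // l; apply: kspan_gen.
  by exists (coordX k i l), (coordX k l j); split=> //; apply: mcoefX.
- move=> i j; rewrite comult_xt; apply: subspace_sum => // l.
  case: (sub (mcoef xt 0 1)) => _ _; apply; apply: kspan_gen.
  by exists (xt l j), (xt i l); split=> //; apply: mcoefT.
- move=> r s r' s' x y _ IHx _ IHy; rewrite DM.
  have [S0 SD SZ] := sub (mcoef xt (r + r') (s + s')).
  move: IHx; apply: (@kspan_sub _ _ _ (fun t => tensor_square _ (coordGL2_mul t _))).
    split=> [|t u|c t]; rewrite ?coordGL2_mul0l ?coordGL2_mulDl ?coordGL2_mulZl //.
      exact: SD.
    exact: SZ.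
  move=> _ [x1 [x2 [hx1 hx2 ->]]].
  move: IHy; apply: (@kspan_sub _ _ _ (fun t => tensor_square _ (coordGL2_mul _ t))).
    split=> [|t u|c t]; rewrite ?coordGL2_mul0r ?coordGL2_mulDr ?coordGL2_mulZr //.
      exact: SD.
    exact: SZ.
  move=> _ [y1 [y2 [hy1 hy2 ->]]].
  (* The inner factors [x2] and [y1] must be homogeneous for the sign rule; [mcoef_spart] keeps
     their components in the same bidegree. *)
  rewrite -(spart_sum x2) -(spart_sum y1) !pureDl !pureDr !(coordGL2_mulDl, coordGL2_mulDr).
  have hP b c : tensor_square (mcoef xt (r + r') (s + s'))
      (coordGL2_mul (x1 ⊗ spart b x2) (spart c y1 ⊗ y2)).
    rewrite (coordGL2_mul_pure _ _ (homogeneous_spart _ _) (homogeneous_spart _ _)).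
    apply: SZ; apply: kspan_gen; exists (x1 * spart c y1), (spart b x2 * y2).
    by split=> //; apply: mcoefM => //; apply: mcoef_spart.
  by apply: (SD); apply: (SD); apply: hP.
Qed.

End SuperTensorSquare.

(** * Evaluation at scalar matrices and separation of degrees *)

Section Torus.
Variables (k : fieldType) (m n : nat).
Local Notation H := (coordGL k m n).
Variables (c : k) (c0 : c != 0).

(* The algebra morphism H -> k which sends X to the scalar matrix c. *)
Definition chi (h : H) : k :=
  gl_eval (fun i j : 'I_(m + n) => (i == j)%:R * c : k^o)
    (c ^- (m + n) : k^o) (generic_quotient.repr h).

(** The diagonal blocks of the scalar matrix have determinants c^m and c^n, so [c ^- (m + n)] is the
    right value for the inverse of d1 d2; the odd variables go to 0, which respects the sign
    rule. *)
Lemma chi_class s : chi (glclass s) =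
  gl_eval (fun i j : 'I_(m + n) => (i == j)%:R * c : k^o) (c ^- (m + n) : k^o) s.
Proof.
have detc p (e : 'I_p -> 'I_(m + n)) : injective e ->
    \det (\matrix_(i, j) ((e i == e j)%:R * c : k^o)) = c ^+ p.
  move=> e_inj; rewrite -(det_scalar p c); congr (\det _).
  by apply/matrixP => i j; rewrite !mxE (inj_eq e_inj) mulr_natl.
pose f (i j : 'I_(m + n)) : k^o := (i == j)%:R * c.
apply: (@gl_eval_eqv k m n k^o f (c ^- (m + n)) _ _ _ _ _ (gl_repr_class s)).
- move=> i j l p; rewrite /f; have [->|ij] := eqVneq i j; last by rewrite !mul0r !mulr0.
  by rewrite addbb /= expr0 mul1r mulrC.
- rewrite !detc; [|exact: rshift_inj|exact: lshift_inj].
  by rewrite -exprD mulVf // expf_neq0.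
- rewrite !detc; [|exact: rshift_inj|exact: lshift_inj].
  by rewrite -exprD mulfV // expf_neq0.
Qed.

Lemma chiD x y : chi (x + y) = chi x + chi y.
Proof.
by elim/glclassW: x => s; elim/glclassW: y => t; rewrite glclass_add !chi_class.
Qed.

Lemma chiM x y : chi (x * y) = chi x * chi y.
Proof.
by elim/glclassW: x => s; elim/glclassW: y => t; rewrite glclass_mul !chi_class.
Qed.

Lemma chi_alg a : chi a%:A = a.
Proof. by rewrite -glclass_cst chi_class /= [LHS]mulr1. Qed.

Lemma chiZ a x : chi (a *: x) = a * chi x.
Proof. by rewrite -mulr_algl chiM chi_alg. Qed.

Lemma chi1 : chi 1 = 1.
Proof. by have := chi_alg 1; rewrite scale1r. Qed.

Lemma chi0 : chi 0 = 0.
Proof. by rewrite -(scale0r 1) chi_alg. Qed.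

Lemma chiX i j : chi (coordX k i j) = (i == j)%:R * c.
Proof. exact: chi_class. Qed.

Variables (eps : H -> k) (xt : 'M[H]_(m + n)).
Hypothesis eps_counit : is_counit eps.
Hypothesis xt_inv : is_inverse_mx xt.

Lemma chi_xt i j : chi (xt i j) = (i == j)%:R / c.
Proof.
have chi_sum (F : 'I_(m + n) -> H) : chi (\sum_l F l) = \sum_l chi (F l).
  exact: (big_morph _ chiD chi0).
have := congr1 chi (mulX_xt xt_inv i j).
rewrite chi_sum (bigD1 i) //= big1 => [|l li]; last first.
  by rewrite chiM chiX eq_sym (negPf li) !mul0r.
rewrite chiM chiX eqxx mul1r addr0 => E.
by apply: (mulfI c0); rewrite E mulrC divfK //; case: (i == j); rewrite ?chi1 ?chi0.
Qed.

Lemma eps_xt i j : eps (xt i j) = (i == j)%:R.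
Proof.
have [es _ e1 eM eX] := eps_counit; have [e0 eD _] := scalarE es.
have eps_sum (F : 'I_(m + n) -> H) : eps (\sum_l F l) = \sum_l eps (F l).
  exact: (big_morph _ eD e0).
have := congr1 eps (mulX_xt xt_inv i j).
rewrite eps_sum (bigD1 i) //= big1 => [|l li]; last first.
  by rewrite eM eX eq_sym (negPf li) !mul0r.
by rewrite eM eX eqxx mul1r addr0 => ->; case: (i == j).
Qed.

(** Both functionals are multiplicative, and [chi] is c times [eps] on the entries of X and c^-1
    times [eps] on those of [xt]. *)
Lemma chi_mcoef r s x : mcoef xt r s x -> chi x = c ^ (r%:Z - s%:Z) * eps x.
Proof.
have [es _ e1 eM eX] := eps_counit; have [e0 eD eZ] := scalarE es.
elim=> {r s x}.
- by move=> r s; rewrite chi0 e0 mulr0.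
- by move=> r s x y _ IHx _ IHy; rewrite chiD eD IHx IHy mulrDr.
- by move=> r s a x _ IHx; rewrite chiZ eZ IHx mulrCA.
- by move=> r; rewrite subrr expr0z chi1 e1 mul1r.
- by move=> i j; rewrite chiX eX subr0 expr1z mulrC.
- by move=> i j; rewrite chi_xt eps_xt sub0r mulrC.
- move=> r s r' s' x y _ IHx _ IHy; rewrite chiM eM IHx IHy !PoszD.
  by rewrite opprD addrACA [in RHS]expfzDr // mulrACA.
Qed.

End Torus.

(** Given [s], a root of X times the product of the X - a, plus 1, is nonzero and differs from every
    element of [s]. *)
Lemma closedField_many (k : closedFieldType) (p : nat) :
  exists s : seq k, [/\ uniq s, size s = p & forall a, a \in s -> a != 0].
Proof.
elim: p => [|p [s [us sp s0]]]; first by exists [::].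
pose P := \prod_(a <- s) ('X - a%:P).
have P0 : P != 0 by apply/monic_neq0/monic_prod_XsubC.
have /closed_rootP[a] : size (P * 'X + 1) != 1%N.
  by rewrite size_polyDl size_mulX ?size_prod_XsubC ?size_poly1.
rewrite /root hornerD hornerMX hornerC => /eqP qa; exists (a :: s); split=> /=.
- rewrite us andbT -root_prod_XsubC; apply/negP => /rootP Pa.
  by move/eqP: qa; rewrite Pa mul0r add0r oner_eq0.
- by rewrite sp.
- move=> b; rewrite inE => /orP[/eqP->|/s0//]; apply/eqP => a0.
  by move/eqP: qa; rewrite a0 mulr0 add0r oner_eq0.
Qed.

(* The inverse of a Vandermonde matrix combines the [chi c] into the functional
   which is the counit in degree z and vanishes in the other degrees y, provided
   all degrees considered are at most N. *)
Lemma degree_functional (k : closedFieldType) (m n : nat) (eps : coordGL k m n -> k)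
    (xt : 'M[coordGL k m n]_(m + n)) N (z : int) :
    is_counit eps -> is_inverse_mx xt -> (`|z| <= N)%N ->
  exists lam : coordGL k m n -> k, scalar lam /\
    forall (y : int) x, (`|y| <= N)%N -> deg_coef xt y x ->
      lam x = if y == z then eps x else 0.
Proof.
move=> eps_counit xt_inv zN.
have [a [ua sa a0]] := @closedField_many k (N + N).+1.
have aj0 (j : 'I_(N + N).+1) : a`_j != 0 by apply: a0; apply: mem_nth; rewrite sa.
pose Vm := Vandermonde (N + N).+1 (\row_(j < (N + N).+1) a`_j).
have Vu : Vm \in unitmx.
  rewrite unitmxE det_Vandermonde unitfE; apply/prodf_neq0 => i _.
  apply/prodf_neq0 => j ij; rewrite !mxE subr_eq0 nth_uniq ?sa //.
  by rewrite eq_sym neq_ltn ij.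
(* Degrees from -N to N are shifted to the row indices 0, ..., 2N. In degree y, [chi a_j] is a_j^y
   times [eps], so the factor a_j^N produces the Vandermonde entries a_j^(y + N). *)
pose idx (y : int) : 'I_(N + N).+1 := inord (absz (y + N%:Z)%R).
pose lam (x : coordGL k m n) :=
  \sum_(j < (N + N).+1) a`_j ^+ N * invmx Vm j (idx z) * chi a`_j x.
exists lam; split=> [c x y|y x yN [r [s [rs rsx]]]].
  rewrite /lam mulr_sumr -big_split; apply: eq_bigr => j _.
  by rewrite chiD // chiZ // mulrDr [in LHS]mulrCA.
transitivity ((Vm *m invmx Vm) (idx y) (idx z) * eps x).
  rewrite mxE mulr_suml; apply: eq_bigr => j _; rewrite !mxE.
  rewrite (chi_mcoef (aj0 j) eps_counit xt_inv rsx) rs inordK; last by lia.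
  have -> : a`_j ^+ absz (y + N%:Z)%R = a`_j ^+ N * a`_j ^ y.
    rewrite -[LHS]/(_ ^ (absz (y + N%:Z)%R)%:Z) -[_ ^+ N]/(_ ^ N%:Z) -expfzDr //.
    by congr (_ ^ _); lia.
  by rewrite mulrACA mulrA.
rewrite mulmxV // mxE.
have -> : (idx y == idx z) = (y == z).
  apply/eqP/eqP => [/(congr1 val)|->//]; rewrite /= !inordK; lia.
by case: (y == z); rewrite ?mul1r ?mul0r.
Qed.

(** * Tensor products of linear maps and of functionals *)

Section TensorMapProp.
Variable k : fieldType.

(** These variants take linearity as a hypothesis, the form in which it is known for [tau] and
    [Delta]. *)
Lemma tmap_bilinearP (U W U' W' : lmodType k) (f : U -> U') (g : W -> W') :
  linear f -> linear g -> bilinear_map (fun u w => f u ⊗ g w).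
Proof.
by move=> lf lg; split=> [w c u u'|u c w w']; rewrite ?lf ?lg ?pureDl ?pureDr ?pureZl ?pureZr.
Qed.

Lemma tmap_pureP (U W U' W' : lmodType k) (f : U -> U') (g : W -> W') u w :
  linear f -> linear g -> tmap f g (u ⊗ w) = f u ⊗ g w.
Proof. by move=> lf lg; apply: (tlift_pure (tmap_bilinearP lf lg)). Qed.

Lemma tmap_linearP (U W U' W' : lmodType k) (f : U -> U') (g : W -> W') :
  linear f -> linear g -> linear (tmap f g).
Proof. by move=> lf lg; apply: (tlift_is_linear (tmap_bilinearP lf lg)). Qed.

Variables U W Z : lmodType k.

Lemma tassoc_on_bilinear z : bilinear_map (fun (u : U) (w : W) => u ⊗ (w ⊗ z : tensor W Z)).
Proof.
by split=> [w c u u'|u c w w']; rewrite !(pureDl, pureDr, pureZl, pureZr).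
Qed.

Lemma tassoc_bilinear :
  bilinear_map (fun x (z : Z) => tlift (fun (u : U) (w : W) => u ⊗ (w ⊗ z)) x).
Proof.
split=> [z|x c z z']; first exact: (tlift_is_linear (tassoc_on_bilinear z)).
pose L (z1 : Z) := @linear_funE k (tensor U W) (tensor U (tensor W Z)) _
  (tlift_is_linear (tassoc_on_bilinear z1)).
elim/tensor_ind: x => [u w||x y IHx IHy].
- rewrite !(tlift_pure (tassoc_on_bilinear _)).
  by rewrite !(pureDl, pureDr, pureZl, pureZr).
- by case: (L z) => -> _ _; case: (L z') => -> _ _; case: (L (c *: z + z')) => -> _ _;
    rewrite scaler0 addr0.
- case: (L z) => _ -> _; case: (L z') => _ -> _; case: (L (c *: z + z')) => _ -> _.
  by rewrite IHx IHy scalerDr addrACA.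
Qed.

Lemma tassoc_pure (x : tensor U W) (z : Z) :
  tassoc (x ⊗ z) = tlift (fun (u : U) (w : W) => u ⊗ (w ⊗ z)) x.
Proof. exact: (tlift_pure tassoc_bilinear). Qed.

Lemma tassoc_linear : linear (@tassoc k U W Z).
Proof. exact: (tlift_is_linear tassoc_bilinear). Qed.

Lemma tassoc_pure3 (u : U) (w : W) (z : Z) : tassoc ((u ⊗ w) ⊗ z) = u ⊗ (w ⊗ z).
Proof. by rewrite tassoc_pure (tlift_pure (tassoc_on_bilinear z)). Qed.

(** The functional [lam] ⊗ [mu], with k ⊗ k identified with k. *)
Definition pairing (lam : W -> k) (mu : Z -> k) (t : tensor W Z) : k :=
  tlift (fun w z => lam w * mu z : k^o) t.

Lemma pairing_bilinear lam mu : scalar lam -> scalar mu ->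
  bilinear_map (fun (w : W) (z : Z) => lam w * mu z : k^o).
Proof.
move=> ls ms; split=> [z c w w'|w c z z']; rewrite ?ls ?ms.
  by rewrite mulrDl -mulrA.
by rewrite mulrDr mulrCA.
Qed.

Lemma pairing_pure lam mu w z : scalar lam -> scalar mu ->
  pairing lam mu (w ⊗ z) = lam w * mu z.
Proof. by move=> ls ms; rewrite /pairing (tlift_pure (pairing_bilinear ls ms)). Qed.

Lemma pairing_scalar lam mu : scalar lam -> scalar mu -> scalar (pairing lam mu).
Proof. by move=> ls ms; apply: (tlift_is_linear (pairing_bilinear ls ms)). Qed.

End TensorMapProp.

(** * The action of the dual of H on a supercomodule, and coefficient spaces *)

Section Comodule.
Variables (k : fieldType) (m n : nat).
Local Notation H := (coordGL k m n).
Variables (Delta : H -> H ⊗ H) (eps : H -> k).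
Hypothesis Delta_linear : linear Delta.
Hypothesis eps_scalar : scalar eps.
Variables (V : superVectType k) (tau : V -> V ⊗ H).
Hypothesis V_comod : is_supercomodule Delta eps tau.

Definition dual_act (lam : H -> k) (v : V) : V := evt lam (tau v).

Definition convolution (lam mu : H -> k) (h : H) : k := pairing lam mu (Delta h).

Lemma convolution_scalar lam mu :
  scalar lam -> scalar mu -> scalar (convolution lam mu).
Proof.
by move=> ls ms c x y; rewrite /convolution Delta_linear (pairing_scalar ls ms).
Qed.

Lemma dual_act_linear lam : scalar lam -> linear (dual_act lam).
Proof.
move=> ls c u v; case: V_comod => tl _ _ _.
by rewrite /dual_act tl (evt_linear ls).
Qed.

Lemma dual_act_counit v : dual_act eps v = v.
Proof. by case: V_comod => _ _ _; apply. Qed.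

(** Coassociativity: both sides contract the twofold coaction, in V ⊗ H ⊗ H, with id ⊗ [lam] ⊗
    [mu]. *)
Lemma dual_act_convolution lam mu v : scalar lam -> scalar mu ->
  dual_act lam (dual_act mu v) = dual_act (convolution lam mu) v.
Proof.
move=> ls ms; have [tl _ coassoc _] := V_comod.
have ps := pairing_scalar ls ms; have cs := convolution_scalar ls ms.
have lid (A : lmodType k) : linear (@id A) by [].
have [t0 tD tZ] := linear_funE tl.
have [p0 pD pZ] := linear_funE (evt_linear (V := V) ps).
have [l0 lD lZ] := linear_funE (evt_linear (V := V) ls).
have [m0 mD mZ] := linear_funE (evt_linear (V := V) ms).
have [c0 cD cZ] := linear_funE (evt_linear (V := V) cs).
have [a0 aD aZ] := linear_funE (@tassoc_linear k V H H).
transitivity (evt (pairing lam mu) (tassoc (tmap tau id (tau v)))).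
  have [f0 fD _] := linear_funE (tmap_linearP tl (lid H)).
  rewrite /dual_act; elim/tensor_ind: (tau v) => [u h||x y IHx IHy].
  - rewrite tmap_pureP // evt_pure // tZ lZ.
    elim/tensor_ind: (tau u) => [w g||x y IHx IHy].
    + by rewrite tassoc_pure3 !evt_pure // pairing_pure // scalerA mulrC.
    + by rewrite pure0l a0 p0 l0 scaler0.
    + by rewrite lD scalerDr IHx IHy pureDl aD pD.
  - by rewrite m0 t0 l0 f0 a0 p0.
  - by rewrite mD tD lD fD aD pD IHx IHy.
rewrite coassoc /dual_act; have [f0 fD _] := linear_funE (tmap_linearP (lid V) Delta_linear).
elim/tensor_ind: (tau v) => [u h||x y IHx IHy].
- by rewrite tmap_pureP // !evt_pure.
- by rewrite f0 p0 c0.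
- by rewrite fD pD cD IHx IHy.
Qed.

Definition subcoalgebra (C : H -> Prop) :=
  [/\ is_subspace C, forall b h, C h -> C (spart b h)
    & forall h, C h -> tensor_square C (Delta h)].

Lemma convolution_eq0 (C : H -> Prop) lam mu h : scalar lam -> scalar mu ->
    tensor_square C (Delta h) ->
    (forall x y, C x -> C y -> lam x * mu y = 0) ->
  convolution lam mu h = 0.
Proof.
move=> ls ms CDh lm; rewrite /convolution; move: CDh.
have [p0 pD pZ] := scalarE (pairing_scalar ls ms).
apply: (@kspan_sub _ _ _ (fun t => pairing lam mu t = 0)).
  by split=> // [s t s0 t0|c t t0]; rewrite ?pD ?pZ ?s0 ?t0 ?addr0 ?mulr0.
by move=> _ [x [y [Cx Cy ->]]]; rewrite pairing_pure // lm.
Qed.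

Lemma coef_in_subspace (C : H -> Prop) : is_subspace (coef_in (V := V) C).
Proof.
split=> [|x y [s [Cs ->]] [t [Ct ->]]|c x [s [Cs ->]]].
- by exists [::]; rewrite big_nil.
- exists (s ++ t); rewrite big_cat; split=> // p.
  by rewrite mem_cat => /orP[/Cs|/Ct].
- exists [seq (c *: p.1, p.2) | p <- s]; split=> [p /mapP[q /Cs Cq ->]//|].
  by rewrite big_map scaler_sumr; apply: eq_bigr => p _; rewrite pureZl.
Qed.

Lemma coef_in_pure (C : H -> Prop) (u : V) h : C h -> coef_in C (u ⊗ h).
Proof.
by move=> Ch; exists [:: (u, h)]; rewrite big_seq1; split=> // p; rewrite inE => /eqP->.
Qed.

Lemma coef_vspace (C : H -> Prop) :
  exists U : {vspace V}, forall v, v \in U <-> coef_in C (tau v).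
Proof.
apply: subspace_vspace; have [C0 CD CZ] := coef_in_subspace C.
have [t0 tD tZ] : _ := linear_funE (let: And4 tl _ _ _ := V_comod in tl).
by split=> [|u v Cu Cv|c v Cv]; rewrite ?t0 ?tD ?tZ; auto.
Qed.

Lemma coef_vspace_sub (C : H -> Prop) (U : {vspace V}) : subcoalgebra C ->
  (forall v, v \in U <-> coef_in C (tau v)) -> is_subsupermodule tau U.
Proof.
move=> [subC spC DC] UP; have [tl tsp _ _] := V_comod; split=> [b v|v vU].
  move=> /UP Cv; apply/UP; rewrite tsp.
  have [C0 CD CZ] := coef_in_subspace C.
  case: Cv => s [Cs ->]; rewrite linear_sum big_seq.
  apply: (big_ind (coef_in C)) => // p /Cs Cp.
  rewrite -[X in coef_in C X]/(tensor_spart b (p.1 ⊗ p.2)) tensor_spart_pure.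
  by apply: CD; apply: coef_in_pure; apply: spC.
(* If [lam] vanishes on [C], so does its convolution with [mu], because [Delta] maps [C] into C ⊗ C;
   hence the dual of H preserves [U]. *)
have actU mu : scalar mu -> dual_act mu v \in U.
  move=> ms; apply/UP/(coef_inP _ subC) => lam ls lC.
  have := dual_act_convolution v ls ms; rewrite {1}/dual_act => ->.
  have /UP/(coef_inP _ subC) := vU; apply; first exact: convolution_scalar.
  move=> h /DC; move/convolution_eq0; apply=> // x y Cx _.
  by rewrite lC // mul0r.
have [c tE] := tensor_coords (tau v).
(* The basis vectors in the expansion of [tau v] are projected onto [U]. This leaves [tau v]
   unchanged, since all its contractions already lie in [U]. *)
exists [seq (projv U (vbasis fullv)`_i, c i) | i : 'I_(\dim (@fullv k V)) <- index_enum _].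
split=> [p /mapP[i _ ->]|]; first exact: memv_proj.
rewrite big_map; apply: evt_inj => mu ms.
have -> : evt mu (tau v) = projv U (evt mu (tau v)) by rewrite projv_id // actU.
rewrite tE !evt_sum // linear_sum; apply: eq_bigr => i _.
by rewrite !evt_pure // linearZ.
Qed.

Lemma subsupermodule_matrix (U : {vspace V}) p (w : p.-tuple V) :
    is_subsupermodule tau U -> basis_of U w ->
  exists a : 'M[H]_p, forall j, tau (tnth w j) = \sum_i tnth w i ⊗ a i j.
Proof.
move=> [_ subU] bw.
have col v : v \in U -> exists c : 'I_p -> H, tau v = \sum_i tnth w i ⊗ c i.
  move=> /subU[s [sU ->]]; elim: s sU => [|q s IH] sU.
    by exists (fun=> 0); rewrite big_nil big1 // => i _; apply: pure0r.
  have [|c E] := IH; first by move=> r rs; apply: sU; rewrite inE rs orbT.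
  exists (fun i => coord w i q.1 *: q.2 + c i).
  rewrite big_cons E.
  have -> : q.1 ⊗ q.2 = \sum_i tnth w i ⊗ (coord w i q.1 *: q.2).
    rewrite {1}(coord_basis bw (sU _ (mem_head _ _))).
    transitivity (\sum_(i < p) (coord w i q.1 *: w`_i) ⊗ q.2).
      apply: (big_morph (fun u : V => u ⊗ q.2)) => [u v'|]; first exact: pureDl.
      exact: pure0l.
    by apply: eq_bigr => i _; rewrite (tnth_nth 0) pureZl pureZr.
  by rewrite -big_split; apply: eq_bigr => i _; rewrite pureDr.
have /choice[c cE] j : exists c : 'I_p -> H, tau (tnth w j) = \sum_i tnth w i ⊗ c i.
  by apply: col; apply: (basis_mem bw); apply: mem_tnth.
exists (\matrix_(i, j) c j i) => j; rewrite cE.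
by apply: eq_bigr => i _; rewrite mxE.
Qed.

(** Stability under the parity projections splits [U] into its even and odd parts, and their bases
    are concatenated. *)
Lemma homogeneous_basis (U : {vspace V}) :
    (forall b v, v \in U -> spart b v \in U) ->
  exists w : (\dim U).-tuple V, basis_of U w /\
    forall i, exists b, homogeneous b (tnth w i).
Proof.
move=> spU; pose P b : {vspace V} := (linfun (spart b) @: U)%VS.
have Phom b v : v \in P b -> homogeneous b v.
  by move=> /memv_imgP[u _ ->]; rewrite lfunE /homogeneous /= spart_idem eqxx.
have PU b : (P b <= U)%VS.
  by apply/subvP => v /memv_imgP[u uU ->]; rewrite lfunE; apply: spU.
have UE : (P false + P true = U)%VS.
  apply: subv_anti; rewrite subv_add !PU /=; apply/subvP => v vU.
  rewrite -(spart_sum v); apply: memv_add; apply/memv_imgP; exists v => //;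
  by rewrite lfunE.
have P0 : (P false :&: P true = 0)%VS.
  apply/eqP; rewrite -subv0; apply/subvP => v; rewrite memv_cap => /andP[/Phom v0 /Phom v1].
  by rewrite memv0 -v0 -v1 spart_idem.
have dU : (\dim (P false) + \dim (P true))%N = \dim U.
  by rewrite -UE dimv_disjoint_sum.
pose s := vbasis (P false) ++ vbasis (P true).
have bs : basis_of U s.
  rewrite -UE; apply: cat_basis; try exact: vbasisP.
  exact/directv_addP.
have ss : size s == \dim U by rewrite size_cat !size_tuple dU.
exists (Tuple ss); split=> // i.
have := mem_tnth i (Tuple ss); rewrite mem_cat => /orP[] /vbasis_mem /Phom ?;
  by eexists; eassumption.
Qed.

(** A basis is free, so the matrix coefficients are determined by the coaction and must lie in
    [C]. *)
Lemma cf_sub (C : H -> Prop) (U : {vspace V}) : is_subspace C ->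
  (forall v, v \in U -> coef_in C (tau v)) -> forall h, cf tau U h -> C h.
Proof.
move=> subC UC h [w [a [bw _ aE]]]; apply: kspan_sub => // _ [i [j ->]].
have := UC (tnth w j) (basis_mem bw (mem_tnth j w)).
rewrite aE; under eq_bigr do rewrite (tnth_nth 0).
by move=> /(coef_in_free subC (basis_free bw))/(_ i).
Qed.

(** As [cf] only sees homogeneous bases, one is produced first; its matrix entries then give the
    coefficients of [tau v]. *)
Lemma cf_coef_in (C : H -> Prop) (U : {vspace V}) : is_subsupermodule tau U ->
  (forall h, cf tau U h -> C h) -> forall v, v \in U -> coef_in C (tau v).
Proof.
move=> subU cfC v vU.
have [w [bw hw]] := homogeneous_basis (proj1 subU).
have [a aE] := subsupermodule_matrix subU bw.
have aC i j : C (a i j).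
  by apply: cfC; exists w, a; split=> //; apply: kspan_gen; exists i, j.
have [tl _ _ _] := V_comod; have [t0 tD tZ] := linear_funE tl.
have [C0 CD CZ] := coef_in_subspace C.
rewrite (coord_basis bw vU) (big_morph _ tD t0).
apply: (big_ind (coef_in C)) => // j _; rewrite tZ; apply: CZ.
rewrite -tnth_nth aE; apply: (big_ind (coef_in C)) => // i _.
exact: coef_in_pure.
Qed.

End Comodule.

(** * Decomposition by rational degree and the bidegree chains *)

Section RationalDecomposition.
Variables (k : closedFieldType) (m n : nat).
Local Notation H := (coordGL k m n).
Variables (Delta : H -> H ⊗ H) (eps : H -> k) (xt : 'M[H]_(m + n)).
Hypothesis Delta_comult : is_comultiplication Delta.
Hypothesis eps_counit : is_counit eps.
Hypothesis xt_inv : is_inverse_mx xt.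
Variables (V : superVectType k) (tau : V -> V ⊗ H).
Hypothesis V_comod : is_supercomodule Delta eps tau.

Let Delta_linear : linear Delta. Proof. by case: Delta_comult. Qed.
Let eps_scalar : scalar eps. Proof. by case: eps_counit. Qed.

Lemma mcoef_subcoalgebra r s : subcoalgebra Delta (mcoef xt r s).
Proof.
split=> [|b h|h]; [exact: mcoef_subspace|exact: mcoef_spart|exact: mcoef_comult].
Qed.

Lemma deg_coef_subcoalgebra z : subcoalgebra Delta (deg_coef xt z).
Proof.
split=> [|b h [r [s [rs hh]]]|h [r [s [rs hh]]]].
- exact: deg_coef_subspace.
- by exists r, s; split=> //; apply: mcoef_spart.
- apply: kspan_sub (mcoef_comult Delta_comult xt_inv hh); first exact: kspan_subspace.
  move=> _ [x [y [hx hy ->]]]; apply: kspan_gen.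
  by exists x, y; split=> //; exists r, s.
Qed.

(** In a basis of V the coaction has finitely many coefficients, each of bounded degree. *)
Lemma coef_in_degle v : 2%N \notin [pchar k] -> exists N, coef_in (degle xt N) (tau v).
Proof.
move=> char_k; have [c ->] := tensor_coords (tau v).
have /choice[N cN] i := coordGL_generated xt_inv char_k (c i).
exists (\max_i N i)%N.
exists [seq ((vbasis fullv)`_i, c i) | i : 'I_(\dim (@fullv k V)) <- index_enum _].
rewrite big_map; split=> // p /mapP[i _ ->].
by apply: degle_leq (cN i); apply: leq_bigmax.
Qed.

(** By [evt_ext] only the values of [lam] in degree [y] matter; there it agrees with the counit,
    which acts as the identity, or with 0. *)
Lemma dual_act_deg y lam a (v : V) : scalar lam -> coef_in (deg_coef xt y) (tau v) ->
    (forall x, deg_coef xt y x -> lam x = if a then eps x else 0) ->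
  dual_act tau lam v = if a then v else 0.
Proof.
move=> ls /(coef_inP _ (deg_coef_subspace xt y)) vy lamE.
have zs : scalar (fun _ : H => 0 : k) by move=> c x x'; rewrite mulr0 addr0.
case: a lamE => lamE.
  rewrite -[RHS](dual_act_counit V_comod); apply: evt_ext vy lamE => //.
have -> : dual_act tau lam v = dual_act tau (fun=> 0) v by apply: evt_ext vy lamE.
have [s [_ tE]] : coef_in (fun=> True) (tau v).
  by apply/coef_inP => // lam' ls' /(_ _ I) lam0; apply: vy => // h _; apply: lam0.
rewrite /dual_act tE evt_sum // big1 // => p _.
by rewrite evt_pure // scale0r.
Qed.

Lemma rational_direct_sum (Vz : int -> {vspace V}) : 2%N \notin [pchar k] ->
  (forall z v, v \in Vz z <-> coef_in (deg_coef xt z) (tau v)) -> is_direct_sum Vz.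
Proof.
move=> char_k VzP; split=> [v|s f us fV f0 i si].
  have [N vN] := coef_in_degle v char_k.
  (* [lam z] acts as the projection to degree z; beyond the bound N it is 0 by default. *)
  have /choice[lam lamP] (z : int) : exists lam : H -> k, scalar lam /\
      ((`|z| <= N)%N -> forall (y : int) x, (`|y| <= N)%N -> deg_coef xt y x ->
         lam x = if y == z then eps x else 0).
    have [zN|zN] := leqP `|z|%N N.
      have [lam [ls lamE]] := degree_functional eps_counit xt_inv zN.
      by exists lam; split.
    by exists (fun=> 0); split=> // c x y; rewrite mulr0 addr0.
  pose s := [seq i%:Z - N%:Z | i <- iota 0 (N + N).+1].
  have sP (z : int) : (z \in s) = (`|z| <= N)%N.
    apply/mapP/idP => [[i]|zN]; first by rewrite mem_iota => ? ->; lia.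
    by exists (absz (z + N%:Z)%R); rewrite ?mem_iota; lia.
  have us : uniq s by rewrite map_inj_uniq ?iota_uniq // => i j; lia.
  exists s, (fun z => if (`|z| <= N)%N then dual_act tau (lam z) v else 0); split=> // [z|].
    case: ifP => zN; last exact: mem0v.
    (* A functional [mu] vanishing in degree z kills this component: the convolution is 0 in every
       degree y <> z because of [lam z], and in degree z because of [mu]. *)
    apply/VzP/(coef_inP _ (deg_coef_subspace xt z)) => mu ms muC.
    have [ls lE] := lamP z.
    have := dual_act_convolution Delta_linear V_comod v ms ls; rewrite {1}/dual_act => ->.
    have [l [lN tE]] := vN; rewrite /dual_act tE.
    have cs := convolution_scalar Delta_linear ms ls.
    have [_ cD _] := scalarE cs.
    rewrite evt_sum // big_seq big1 // => p /lN pN; rewrite evt_pure //.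
    suff -> : convolution Delta mu (lam z) p.2 = 0 by rewrite scale0r.
    elim: pN => [y x yN xy|x y _ x0 _ y0]; last by rewrite cD x0 y0 addr0.
    have [_ _ DC] := deg_coef_subcoalgebra y.
    apply: (convolution_eq0 ms ls (DC _ xy)) => a b ya yb.
    rewrite (lE zN _ _ yN yb); case: eqP => [yz|_]; last by rewrite mulr0.
    by rewrite muC ?mul0r // -yz.
  (* The functionals [lam z] for z in [s] add up to the counit on [degle xt N]. *)
  rewrite -[LHS](dual_act_counit V_comod) big_seq.
  under eq_bigr => z zs do rewrite -sP zs.
  rewrite -big_seq /dual_act; have [l [lN ->]] := vN.
  have lams z := proj1 (lamP z).
  rewrite evt_sum //; under [RHS]eq_bigr do rewrite (evt_sum _ _ (lams _)).
  rewrite exchange_big big_seq [RHS]big_seq; apply: eq_bigr => p /lN pN /=.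
  under [RHS]eq_bigr do rewrite (evt_pure _ _ (lams _)).
  rewrite evt_pure // -scaler_suml; congr (_ *: _).
  elim: pN => [y x yN xy|x y _ IHx _ IHy]; last first.
    have [_ -> _] := scalarE eps_scalar; rewrite IHx IHy -big_split; apply: eq_bigr => z _.
    by have [_ -> _] := scalarE (lamP z).1.
  rewrite (bigD1_seq y) ?sP //= ((lamP y).2 yN _ _ yN xy) eqxx big_seq_cond.
  rewrite big1 ?addr0 // => z /andP[]; rewrite sP => zN zy.
  by rewrite ((lamP z).2 zN _ _ yN xy) eq_sym (negPf zy).
(* For independence, the functional selecting degree [i] is applied to the relation, with N bounding
   all its degrees. *)
pose N := (\max_(j <- s) `|j|)%N.
have sN j : j \in s -> (`|j| <= N)%N by move=> js; apply: (@leq_bigmax_seq _ s xpredT absz j js).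
have [lam [ls lamE]] := degree_functional eps_counit xt_inv (sN i si).
have actE j : j \in s -> dual_act tau lam (f j) = if j == i then f j else 0.
  move=> js; apply: (dual_act_deg ls (proj1 (VzP j (f j)) (fV j))) => x.
  exact: lamE (sN j js).
have [a0 aD _] := linear_funE (dual_act_linear V_comod ls).
have := congr1 (dual_act tau lam) f0; rewrite a0 (big_morph _ aD a0) (bigD1_seq i) //=.
rewrite actE // eqxx big_seq_cond big1 ?addr0 // => j /andP[js ji].
by rewrite actE // (negPf ji).
Qed.

Lemma rational_bidegree_chain r s (U : {vspace V}) : (r = 0 \/ s = 0)%N ->
    (forall v, v \in U <-> coef_in (deg_coef xt (r%:Z - s%:Z)) (tau v)) ->
  exists W : nat -> {vspace V}, is_bidegree_chain tau xt U r s W.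
Proof.
move=> rs UP.
(* By [cf_coef_in], [W t] contains every subsupermodule with coefficients in this bidegree, which
   gives the strictness required below. *)
have /choice[W WP] t := coef_vspace V_comod (mcoef xt (r + t) (s + t)).
have subW t : is_subsupermodule tau (W t).
  apply: (coef_vspace_sub Delta_linear V_comod (mcoef_subcoalgebra _ _)).
  exact: WP.
have coef_mono (C D : H -> Prop) x : (forall h, C h -> D h) ->
    coef_in C x -> coef_in (V := V) D x.
  by move=> CD [l [lC ->]]; exists l; split=> // p /lC /CD.
have W_add t u v : v \in W t -> v \in W (t + u)%N.
  move/WP => vt; apply/WP; apply: coef_mono vt => h.
  by rewrite !addnA; apply: mcoef_add.
have cfW t h : cf tau (W t) h -> mcoef xt (r + t) (s + t) h.
  by apply: cf_sub; [exact: mcoef_subspace|move=> v /WP].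
exists W; split=> // [t|||v].
- by apply/subvP => v /(W_add _ 1%N); rewrite addn1.
- split=> [h /cfW|r0 s0]; last lia.
  by rewrite !addn0; apply: mcoef_mixed_min.
- move=> t tW; have [mn0|mn0] := posnP (m + n).
    (* Without indices the chain is constant, which contradicts its growth at [t]. *)
    case: tW; apply/eqP; rewrite eqEsubv; apply/andP; split; apply/subvP => v.
      move/WP => vt; apply/WP; apply: coef_mono vt => h.
      by rewrite !addnS; apply: mcoef_pred.
    by move/(W_add _ 1%N); rewrite addn1.
  split=> [h /cfW|_ _]; first exact: mcoef_mixed.
  (* If all coefficients of [W t.+1] had the lower bidegree, [W t.+1] would be contained in
     [W t]. *)
  rewrite !addnS /= => cft; apply: tW; apply/eqP; rewrite eqEsubv; apply/andP.
  split; apply/subvP => v.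
    move=> vt; apply/WP; apply: (cf_coef_in V_comod (subW t.+1) _ vt) => h /cft.
    exact: mixed_coef_mcoef.
  by move/(W_add _ 1%N); rewrite addn1.
- split=> [/UP[l [lC tE]]|[t /WP vt]]; last first.
    by apply/UP; apply: coef_mono vt => h ht; apply/deg_coefE => //; exists t.
  have lt p : exists t, p \in l -> mcoef xt (r + t) (s + t) p.2.
    have [pl|npl] := boolP (p \in l); last by exists 0%N.
    by have /(deg_coefE _ _ rs)[t pt] := lC p pl; exists t.
  (* One member of the chain serves all the finitely many terms of [tau v]: the one at the maximum
     of their indices. *)
  have [T TP] := choice lt; exists (\max_(p <- l) T p)%N; apply/WP.
  exists l; split=> // p pl.
  have Tp : (T p <= \max_(q <- l) T q)%N by apply: (@leq_bigmax_seq _ l xpredT T p pl).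
  by rewrite -(subnKC Tp) !addnA; apply: mcoef_add; apply: TP.
Qed.

End RationalDecomposition.

Theorem theorem3p1 (k : closedFieldType) (char_k : 2%N \notin [pchar k])
    (m n : nat)
    (Delta : coordGL k m n -> coordGL k m n ⊗ coordGL k m n)
    (Delta_comult : is_comultiplication Delta)
    (eps : coordGL k m n -> k) (eps_counit : is_counit eps)
    (xt : 'M[coordGL k m n]_(m + n)) (xt_inv : is_inverse_mx xt)
    (V : superVectType k) (tau : V -> V ⊗ coordGL k m n)
    (V_comod : is_supercomodule Delta eps tau) :
  exists Vz : int -> {vspace V},
    [/\ is_direct_sum Vz,
        forall z, is_subsupermodule tau (Vz z) /\
                  has_rational_degree tau xt (Vz z) z,
        forall z, 0 <= z -> exists W : nat -> {vspace V},
          is_bidegree_chain tau xt (Vz z) `|z|%N 0 W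
      & forall z, z < 0 -> exists W : nat -> {vspace V},
          is_bidegree_chain tau xt (Vz z) 0 `|z|%N W].
Proof.
have /choice[Vz VzP] z := coef_vspace V_comod (deg_coef xt z).
have [Dlin _ _ _ _] := Delta_comult.
exists Vz; split=> [|z|z z0|z z0].
- exact: (rational_direct_sum Delta_comult eps_counit xt_inv V_comod char_k VzP).
- split=> [|h cfh].
    have subC := deg_coef_subcoalgebra Delta_comult xt_inv z.
    exact: (coef_vspace_sub Dlin V_comod subC (VzP z)).
  apply: (deg_coef_rational xt_inv); apply: cf_sub cfh; first exact: deg_coef_subspace.
  by move=> v /VzP.
- apply: (rational_bidegree_chain Delta_comult xt_inv V_comod (or_intror erefl)) => v.
  by rewrite subr0 gez0_abs.
- apply: (rational_bidegree_chain Delta_comult xt_inv V_comod (or_introl erefl)) => v.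
  by rewrite sub0r ltz0_abs // opprK.
Qed.
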